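(* Let $n\ge 2$ and $d\in\{1,\ldots,n-1\}$. The functions $\mu_n(\cdot|1)_1,\ldots,\mu_n(\cdot|n-d)_1$ are smoothly independent on $\bigcap_{e=1}^{n-d}\mathcal{I}_n(d,e)_1=\mathcal{I}_n(d,n-d)_1$.
   Context: Norms on $\mathbb{R}^n$ and its exterior powers are Euclidean (the standard basis of each exterior power being orthonormal). A subspace of $\mathbb{R}^n$ is rational if it has a basis of vectors with rational coordinates; $\mathcal{R}_n(e)$ is the set of rational subspaces of dimension $e$ of $\mathbb{R}^n$. The height of $B\in\mathcal{R}_n(e)$ is $H(B)=\|X_1\wedge\cdots\wedge X_e\|$ for any $\mathbb{Z}$-basis $X_1,\ldots,X_e$ of $B\cap\mathbb{Z}^n$ (equivalently, the Euclidean norm of a vector of Plücker coordinates of $B$ with coprime integer entries). Put $g(d,e,n)=\max(0,d+e-n)$. For $1\le j\le \min(d,e)-g(d,e,n)$, a subspace $A$ of dimension $d$ of $\mathbb{R}^n$ is $(e,j)$-irrational if $\dim(A\cap B)<j+g(d,e,n)$ for all $B\in\mathcal{R}_n(e)$; $\mathcal{I}_n(d,e)_j$ is the set of all $(e,j)$-irrational subspaces of dimension $d$ of $\mathbb{R}^n$. For nonzero $X,Y\in\mathbb{R}^n$, $\omega(X,Y)=\|X\wedge Y\|/(\|X\|\,\|Y\|)$. For subspaces $A,B$ of dimensions $d,e$, define inductively $\omega_1(A,B)=\min\{\omega(X,Y): X\in A\setminus\{0\},Y\in B\setminus\{0\}\}$, attained at $(X_1,Y_1)$, and, for $j<\min(d,e)$,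 $\omega_{j+1}(A,B)=\min\{\omega(X,Y): X\in A_j\setminus\{0\},Y\in B_j\setminus\{0\}\}$, attained at $(X_{j+1},Y_{j+1})$, where $A_j$ (resp. $B_j$) is the orthogonal complement of $\mathrm{Span}(X_1,\ldots,X_j)$ in $A$ (resp. of $\mathrm{Span}(Y_1,\ldots,Y_j)$ in $B$). Set $\psi_j(A,B)=\omega_{j+g(d,e,n)}(A,B)$. For $d,e\in\{1,\ldots,n-1\}$, $1\le j\le\min(d,e)-g(d,e,n)$ and $A\in\mathcal{I}_n(d,e)_j$, the exponent $\mu_n(A|e)_j\in[0,+\infty]$ is the supremum of the set of $\mu>0$ such that there are infinitely many $B\in\mathcal{R}_n(e)$ with $\psi_j(A,B)\le H(B)^{-\mu}$. For a set $W$ and functions $f_1,\ldots,f_k:W\to\mathbb{R}\cup\{+\infty\}$, we say $f_1,\ldots,f_k$ are smoothly independent on $W$ if there is no (smooth) submersion $h:\mathbb{R}^k\to\mathbb{R}$ such that for all $w\in W$: $(f_1(w),\ldots,f_k(w))\in\mathbb{R}^k\Rightarrow h(f_1(w),\ldots,f_k(w))=0$. *)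

(* Defs.v *)
From mathcomp Require Export all_boot all_order all_algebra.
From mathcomp Require Export all_classical all_reals all_analysis.
Export numFieldNormedType.Exports.

Set Implicit Arguments.
Unset Strict Implicit.
Unset Printing Implicit Defensive.

Import Order.TTheory GRing.Theory Num.Theory.

Local Open Scope classical_set_scope.
Local Open Scope ring_scope.

Definition dotv (R : realType) (n : nat) (u v : 'rV[R]_n) : R :=
  \sum_i u 0 i * v 0 i.

(* The library norm `|u| on 'rV[R]_n is the sup norm, not the Euclidean one. *)
Definition enorm (R : realType) (n : nat) (u : 'rV[R]_n) : R :=
  Num.sqrt (dotv u u).

Definition strictly_increasing (e n : nat) (s : {ffun 'I_e -> 'I_n}) : bool :=
  [forall i : 'I_e, forall j : 'I_e, (i < j)%N ==> (s i < s j)%N].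

(* || X_1 /\ ... /\ X_e ||, where X_1, ..., X_e are the rows of M: the
   coordinate of X_1 /\ ... /\ X_e on e_(s 1) /\ ... /\ e_(s e) is the minor of
   M on the columns s 1 < ... < s e. *)
Definition wedge_norm (R : realType) (e n : nat) (M : 'M[R]_(e, n)) : R :=
  Num.sqrt (\sum_(s : {ffun 'I_e -> 'I_n} | strictly_increasing s)
              (\det (colsub s M)) ^+ 2).

Definition is_rational (R : realType) (n : nat) (B : {vspace 'rV[R]_n}) : Prop :=
  exists s : seq 'rV[rat]_n, basis_of B [seq map_mx ratr v | v <- s].

Definition rational_subspaces (R : realType) (n e : nat) :
    set {vspace 'rV[R]_n} :=
  [set B | \dim B = e /\ is_rational B].
Arguments rational_subspaces : clear implicits.

(* The rows of M form a Z-basis of the intersection of B with Z^n. *)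
Definition is_Zbasis (R : realType) (n e : nat) (B : {vspace 'rV[R]_n})
    (M : 'M[int]_(e, n)) : Prop :=
  [/\ forall i, map_mx intr (row i M) \in B,
      injective (fun c : 'rV[int]_e => c *m M) &
      forall v : 'rV[int]_n, map_mx intr v \in B ->
        exists c : 'rV[int]_e, v = c *m M].

(* Two Z-bases differ by an integer matrix of determinant 1 or -1, so the value
   does not depend on the basis that is chosen. *)
Definition height (R : realType) (n : nat) (B : {vspace 'rV[R]_n}) : R :=
  wedge_norm (map_mx intr
    (xget 0 [set M : 'M[int]_(\dim B, n) | is_Zbasis B M]) : 'M[R]_(\dim B, n)).

(* With truncated subtraction, this is max(0, d + e - n). *)
Definition gdim (d e n : nat) : nat := (d + e - n)%N.

Definition irrational_subspaces (R : realType) (n d e j : nat) :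
    set {vspace 'rV[R]_n} :=
  [set A | \dim A = d /\
    forall B : {vspace 'rV[R]_n}, rational_subspaces R n e B ->
      (\dim (A :&: B)%VS < j + gdim d e n)%N].
Arguments irrational_subspaces : clear implicits.

Definition omega (R : realType) (n : nat) (X Y : 'rV[R]_n) : R :=
  wedge_norm (col_mx X Y) / (enorm X * enorm Y).

Definition orthogonal_in (R : realType) (n : nat) (A : {vspace 'rV[R]_n})
    (s : seq 'rV[R]_n) : set 'rV[R]_n :=
  [set X | X \in A /\ forall Y, Y \in span s -> dotv X Y = 0].

Definition omega_minimizer (R : realType) (n : nat) (A B : set 'rV[R]_n)
    (p : 'rV[R]_n * 'rV[R]_n) : Prop :=
  [/\ A p.1, p.1 != 0, B p.2, p.2 != 0 &
      forall X Y : 'rV[R]_n, A X -> X != 0 -> B Y -> Y != 0 ->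
        omega p.1 p.2 <= omega X Y].

(* [:: (X_1, Y_1); ...; (X_j, Y_j)]; meaningful for j <= min(dim A, dim B). *)
Fixpoint principal_pairs (R : realType) (n : nat) (A B : {vspace 'rV[R]_n})
    (j : nat) : seq ('rV[R]_n * 'rV[R]_n) :=
  if j is i.+1 then
    let s := principal_pairs A B i in
    rcons s (xget (0, 0) [set p | omega_minimizer
      (orthogonal_in A (unzip1 s)) (orthogonal_in B (unzip2 s)) p])
  else [::].

(* Indices start at 1. The value does not depend on the minimizers chosen in
   principal_pairs: it is the sine of the j-th principal angle of A and B. *)
Definition omega_ (R : realType) (n j : nat) (A B : {vspace 'rV[R]_n}) : R :=
  let p := last (0, 0) (principal_pairs A B j) in omega p.1 p.2.

Definition psi (R : realType) (n j : nat) (A B : {vspace 'rV[R]_n}) : R :=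
  omega_ (j + gdim (\dim A) (\dim B) n) A B.

(* Adding 0 makes this the supremum in [0, +oo]: in \bar R, the supremum of the
   empty set would be -oo. *)
Definition mu_exp (R : realType) (n e j : nat) (A : {vspace 'rV[R]_n}) : \bar R :=
  ereal_sup ([set 0%E] `|`
    [set m%:E | m in [set m : R | 0 < m /\
       infinite_set [set B : {vspace 'rV[R]_n} |
         rational_subspaces R n e B /\ psi j A B <= height B `^ (- m)]]]).

Fixpoint class_C (R : realType) (k m : nat) (f : 'rV[R]_k -> R^o) : Prop :=
  if m is i.+1 then
    (forall a, differentiable f a) /\
    (forall l : 'I_k, class_C i (fun a => 'D_(delta_mx 0 l) f a))
  else continuous f.

Definition is_smooth (R : realType) (k : nat) (f : 'rV[R]_k -> R^o) : Prop :=
  forall m : nat, class_C m f.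

Definition is_submersion (R : realType) (k : nat) (f : 'rV[R]_k -> R^o) : Prop :=
  is_smooth f /\ forall (a : 'rV[R]_k) (y : R), exists v, 'd f a v = y.

(* Functions with values in R U {+oo} are given as functions into \bar R. *)
Definition smoothly_independent (R : realType) (T : Type) (k : nat) (W : set T)
    (f : 'I_k -> T -> \bar R) : Prop :=
  ~ exists h : 'rV[R]_k -> R^o, is_submersion h /\
      forall w, W w -> (forall i, f i w \is a fin_num) ->
        h (\row_i fine (f i w)) = 0.

(* Main.v *)
Require Import Defs.
From mathcomp Require Import perm ring lra zify.

(** The equality of the two sets holds because a rational subspace of dimension
    e <= n - d is contained in one of dimension n - d ([rational_extend]).

    For the independence, write p = d - 1 and k = n - d, so that n = p + 1 + k.
    It is enough to find an open set of points (b_0, ..., b_(k-1)) of R^k each of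
    which is the tuple of exponents of some subspace A: a function h vanishing at
    all of them has a zero differential inside that open set. The open set
    consists of the products b_i = t_0 ... t_i where t_0 > t_1 > ... > t_(k-1)
    are larger than a constant S(n, d).

    Given such a sequence t, extended with period k, let a_(m+1) be about
    t_m a_m. The subspace A is spanned by d vectors of R^n. One of them is the
    lacunary point x: its first p coordinates are 0, the next one is 1, and the
    other k coordinates share the terms of the series of 2^-a_m in turn, the m-th
    term going to the coordinate [dir m]. The partial sums of x, multiplied by
    their denominators 2^a_j, are integer points P_j. The other p vectors
    have as entries powers of one real number, a root of 2 of large degree; they
    are there to fill the dimension d without creating further good
    approximations.

    Upper bound for psi. Since P_(j+1) is a multiple of P_j plus a basis vector,
    the subspace spanned by P_j, ..., P_(j+e-1) is also spanned by P_j and e - 1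
    basis vectors. Its height is therefore of the order of 2^a_j
    ([height_frame_mx]), whereas it contains an approximation of x with error
    about 2^-a_(j+e). Here a_(j+e) is about t_j ... t_(j+e-1) a_j, and among
    windows of length e <= k of a periodic sequence that decreases along its
    period, the product is largest for the one starting with the period
    ([window_le]). This produces the exponent t_0 ... t_(e-1).

    Lower bound for psi. If P_i is not in the rational subspace B, then A with x
    replaced by P_i is at distance at least c / (2^a_i H(B))^N from B, where N
    depends only on n and d ([gen_mx_far]): some d x d determinant is a
    polynomial in the root of 2 with integer coefficients; it is not the zero
    polynomial, because the monomials coming from different choices of entries
    are different, and Liouville's inequality ([root2_liouville]) bounds it from
    below. When 2^a_(i+1) is large compared with (2^a_i H(B))^N, the same holds
    for A itself ([far_step]). Let j be the first index with
    2^a_(j+1) >= H(B)^(2N): then [far_step] applies from j on, while 2^a_j is at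
    most a constant times H(B)^(2N). Let i >= j be minimal such that P_i is not
    in B. If i < j + e, the distance is at least a negative power of H(B) whose
    exponent is of order t_0 ... t_(e-2), which is good enough since t_(e-1) is
    large. If i >= j + e, then B is the subspace spanned by
    P_j, ..., P_(j+e-1), for which the distance to A can be computed
    ([far_frame_mx]). This is [far_rational]. *)

Import Order.TTheory GRing.Theory Num.Theory.

Set Implicit Arguments.
Unset Strict Implicit.
Unset Printing Implicit Defensive.

Local Open Scope classical_set_scope.
Local Open Scope ring_scope.

(** * Determinants and row spaces *)

Lemma ler_norm_det (K : numDomainType) (n : nat) (M : 'M[K]_n) (b : K) :
  (forall i j, `|M i j| <= b) -> `|\det M| <= (n`!)%N%:R * b ^+ n.
Proof.
move=> Mb; rewrite /determinant.
apply: le_trans (ler_norm_sum _ _ _) _.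
have -> : (n`!)%N%:R * b ^+ n = \sum_(s : 'S_n) b ^+ n.
  by rewrite sumr_const card_Sn mulr_natl.
apply: ler_sum => s _; rewrite normrM normrX normrN1 expr1n mul1r normr_prod.
have -> : b ^+ n = \prod_(i < n) b by rewrite prodr_const card_ord.
by apply: ler_prod => i _; rewrite normr_ge0 /=.
Qed.

Lemma ler_norm_adj (K : numDomainType) (n : nat) (M : 'M[K]_n) (b : K) i j :
  (forall i j, `|M i j| <= b) -> `|(\adj M) i j| <= ((n.-1)`!)%N%:R * b ^+ n.-1.
Proof.
move=> Mb; rewrite mxE /cofactor normrM normrX normrN1 expr1n mul1r.
by apply: ler_norm_det => r s; rewrite !mxE.
Qed.

(** Cramer's rule, read as a bound on how much an invertible matrix can shrink a
    row vector. *)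
Lemma cramer_lower_bound (K : numDomainType) (n : nat) (M : 'M[K]_n) (b eps : K)
    (v : 'rV[K]_n) i :
  (forall i j, `|M i j| <= b) -> (forall j, `|(v *m M) 0 j| <= eps) ->
  `|\det M| * `|v 0 i| <= n%:R * ((n.-1)`!)%N%:R * b ^+ n.-1 * eps.
Proof.
move=> Mb veps.
have -> : `|\det M| * `|v 0 i| = `|(v *m M *m \adj M) 0 i|.
  by rewrite -mulmxA mul_mx_adj mul_mx_scalar mxE normrM.
rewrite mxE; apply: le_trans (ler_norm_sum _ _ _) _.
have -> : n%:R * ((n.-1)`!)%N%:R * b ^+ n.-1 * eps =
    \sum_(j < n) eps * (((n.-1)`!)%N%:R * b ^+ n.-1).
  by rewrite sumr_const card_ord -[RHS]mulr_natl; ring.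
apply: ler_sum => j _; rewrite normrM.
by apply: ler_pM => //; exact: ler_norm_adj.
Qed.

(** Multilinearity in the rows: this is the Cauchy-Binet formula before the terms
    are grouped according to the image of [f]. *)
Lemma det_mulmx_rowsub (K : comPzRingType) (d n : nat) (A : 'M[K]_(d, n))
    (B : 'M[K]_(n, d)) :
  \det (A *m B) =
  \sum_(f : {ffun 'I_d -> 'I_n}) (\prod_i A i (f i)) * \det (rowsub f B).
Proof.
rewrite /determinant.
under [RHS]eq_bigr do rewrite big_distrr /=.
rewrite exchange_big /=; apply: eq_bigr => s _.
under eq_bigr do rewrite mxE.
rewrite bigA_distr_bigA /= big_distrr /=; apply: eq_bigr => f _.
rewrite big_split /= mulrCA; congr (_ * (_ * _)).
by apply: eq_bigr => i _; rewrite mxE.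
Qed.

Lemma row_free_minor (F : fieldType) (m n : nat) (M : 'M[F]_(m, n)) :
  row_free M -> exists s : 'I_m -> 'I_n, \det (colsub s M) != 0.
Proof.
rewrite -row_leq_rank -mxrank_tr => rM.
have fT : row_full M^T by rewrite -col_leq_rank.
exists (fullrankfun fT).
have -> : colsub (fullrankfun fT) M = (rowsub (fullrankfun fT) M^T)^T.
  by apply/matrixP=> i j; rewrite !mxE.
by rewrite det_tr -unitfE -unitmxE fullrowsub_unit.
Qed.

Section RowSpace.
Variables (F : fieldType) (m n : nat).

Definition rowv (M : 'M[F]_(m, n)) : {vspace 'rV[F]_n} :=
  limg (linfun (mulmxr M : 'rV[F]_m -> 'rV[F]_n)).

Lemma rowvP (M : 'M[F]_(m, n)) v :
  reflect (exists c : 'rV[F]_m, v = c *m M) (v \in rowv M).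
Proof.
apply: (iffP memv_imgP) => [[c _ ->]|[c ->]]; exists c; rewrite ?memvf ?lfunE //.
Qed.

Lemma dim_rowv (M : 'M[F]_(m, n)) :
  (forall c : 'rV[F]_m, c *m M = 0 -> c = 0) -> \dim (rowv M) = m.
Proof.
move=> Minj; rewrite limg_dim_eq ?dimvf /dim /= ?mul1n //.
apply/eqP; rewrite -subv0; apply/subvP => c.
by rewrite memv_cap memvf memv_ker lfunE /= memv0 => /eqP/Minj ->.
Qed.

Lemma row_in_rowv (M : 'M[F]_(m, n)) i : row i M \in rowv M.
Proof. by apply/rowvP; exists (delta_mx 0 i); rewrite -rowE. Qed.

Lemma rowv_sub (M : 'M[F]_(m, n)) (B : {vspace 'rV[F]_n}) :
  (forall i, row i M \in B) -> (rowv M <= B)%VS.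
Proof.
move=> rB; apply/subvP => v /rowvP[c ->]; rewrite mulmx_sum_row.
by apply: rpred_sum => i _; rewrite rpredZ.
Qed.

Lemma rowv_span (M : 'M[F]_(m, n)) :
  rowv M = <<[seq row i M | i <- enum 'I_m]>>%VS.
Proof.
apply/eqP; rewrite eqEsubv; apply/andP; split.
  by apply: rowv_sub => i; apply/memv_span/map_f; rewrite mem_enum.
by apply/span_subvP => v /mapP[i _ ->]; exact: row_in_rowv.
Qed.

End RowSpace.

(** * Heights of rational subspaces *)

(** Coordinates of exterior powers are indexed by increasing maps; this brings an
    arbitrary choice of distinct columns back to that case, at the cost of a sign. *)
Lemma injective_sort_ord (e n : nat) (s : 'I_e -> 'I_n) : injective s ->
  exists p : {perm 'I_e}, forall i j : 'I_e, (i < j)%N -> (s (p i) < s (p j))%N.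
Proof.
move=> s_inj; pose S := [set s i | i : 'I_e]%SET.
have cS : #|S| = e by rewrite card_imset // card_ord.
pose s' (i : 'I_e) : 'I_n := enum_val (cast_ord (esym cS) i).
have s'S i : s' i \in codom s.
  by have := enum_valP (cast_ord (esym cS) i); rewrite -/(s' i) => /imsetP[j _ ->]; exact: codom_f.
have s'inj : injective s' by move=> i j /enum_val_inj /cast_ord_inj.
pose q i := iinv (s'S i).
have sq i : s (q i) = s' i by rewrite f_iinv.
have qinj : injective q by move=> i j qij; apply: s'inj; rewrite -!sq qij.
exists (perm qinj) => i j ij; rewrite !permE !sq /s'.
have x0 : 'I_n := s i.
rewrite !(enum_val_nth x0).
have S_sorted : sorted (fun a b : 'I_n => (a < b)%N) (enum S).
  apply: sorted_filter; first by move=> ? ? ?; exact: ltn_trans.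
  rewrite -(@sorted_map _ _ val ltn) -enumT val_enum_ord; exact: iota_ltn_sorted.
apply: (@sorted_ltn_nth _ (fun a b : 'I_n => (a < b)%N)) => //=.
- by move=> ? ? ?; exact: ltn_trans.
- by rewrite inE -cardE cS.
- by rewrite inE -cardE cS.
Qed.

Lemma minor_le_wedge_norm (R : realType) (e n : nat) (M : 'M[R]_(e, n))
    (s : 'I_e -> 'I_n) : `|\det (colsub s M)| <= wedge_norm M.
Proof.
have [/injectiveP s_inj|/injectivePn[i [j ij sij]]] := boolP (injectiveb s);
    last first.
  suff -> : \det (colsub s M) = 0 by rewrite normr0 sqrtr_ge0.
  rewrite -det_tr; apply: (determinant_alternate ij) => l.
  by rewrite !mxE sij.
have [p p_incr] := injective_sort_ord s_inj.
have -> : `|\det (colsub s M)| = `|\det (colsub (finfun (s \o p)) M)|.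
  have -> : colsub (finfun (s \o p)) M = col_perm p (colsub s M).
    by apply/matrixP => i j; rewrite !mxE ffunE.
  by rewrite col_permE det_mulmx det_perm normrM normrX normrN1 expr1n mulr1.
rewrite -sqrtr_sqr; apply: ler_wsqrtr.
rewrite (bigD1 (finfun (s \o p))) /=; last first.
  by apply/forallP => i; apply/forallP => j; apply/implyP => ij; rewrite !ffunE /= p_incr.
by rewrite lerDl sumr_ge0 // => ? _; exact: sqr_ge0.
Qed.

Lemma wedge_norm_le (R : realType) (e n : nat) (M : 'M[R]_(e, n)) (b : R) :
  0 <= b -> (forall s : 'I_e -> 'I_n, `|\det (colsub s M)| <= b) ->
  wedge_norm M <= (n ^ e)%N%:R * b.
Proof.
move=> b0 Mb; rewrite -[leRHS]ger0_norm ?mulr_ge0 // -sqrtr_sqr; apply: ler_wsqrtr.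
apply: (@le_trans _ _ (\sum_(s : {ffun 'I_e -> 'I_n}) b ^+ 2)).
  rewrite [leRHS](bigID (@strictly_increasing e n)) /=.
  rewrite -[leLHS]addr0; apply: lerD; last by apply: sumr_ge0 => *; exact: sqr_ge0.
  by apply: ler_sum => s _; rewrite -real_normK ?num_real // lerXn2r ?nnegrE.
rewrite sumr_const card_ffun !card_ord -mulr_natl exprMn.
rewrite mulr1 -natrX -[leLHS]mulr_natl.
apply: ler_wpM2r; rewrite ?sqr_ge0 // ler_nat.
by case: (n ^ e)%N => // m; rewrite -mulnn leq_pmulr.
Qed.

Lemma wedge_norm_mul (R : realType) (e n : nat) (T : 'M[R]_e) (M : 'M[R]_(e, n)) :
  wedge_norm (T *m M) = `|\det T| * wedge_norm M.
Proof.
rewrite /wedge_norm -sqrtr_sqr -sqrtrM ?sqr_ge0 // mulr_sumr.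
congr Num.sqrt; apply: eq_bigr => s _.
by rewrite -exprMn -det_mulmx mulmx_colsub.
Qed.

Lemma clear_denominators (n : nat) (v : 'rV[rat]_n) :
  exists D : int, exists w : 'rV[int]_n, D != 0 /\ map_mx intr w = D%:~R *: v.
Proof.
pose D : int := \prod_j denq (v 0 j).
exists D, (\row_j (numq (v 0 j) * \prod_(i | i != j) denq (v 0 i))); split.
  by apply/prodf_neq0 => j _; exact: denq_neq0.
apply/rowP => j; rewrite !mxE [in RHS]/D [in RHS](bigD1 j) //= !intrM numqE; ring.
Qed.

Lemma rational_int_basis (R : realType) (n : nat) (B : {vspace 'rV[R]_n}) :
  is_rational B -> exists N : 'M[int]_(\dim B, n),
    (forall c : 'rV[R]_(\dim B), c *m map_mx intr N = 0 -> c = 0) /\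
    B = rowv (map_mx intr N).
Proof.
case=> s sB.
have /choice[f fP] : forall v : 'rV[rat]_n, exists p : int * 'rV[int]_n,
    p.1 != 0 /\ map_mx intr p.2 = p.1%:~R *: v.
  by move=> v; have [D [w ?]] := clear_denominators v; exists (D, w).
have ss : size s = \dim B.
  by move: (basis_free sB) (span_basis sB) => /eqP; rewrite size_map => <- ->.
pose X := [seq map_mx (ratr : rat -> R) v | v <- s].
have szX : size X == \dim B by rewrite size_map ss.
pose N := \matrix_(i < \dim B, j < n) (f s`_i).2 0 j.
have rN i : row i (map_mx intr N) = ((f s`_i).1%:~R : R) *: (Tuple szX)`_i.
  apply/rowP => j; rewrite !mxE (nth_map 0) ?ss // !mxE.
  have [_ /rowP/(_ j)] := fP s`_i; rewrite !mxE => /(congr1 (ratr : rat -> R)).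
  by rewrite rmorphM /= !ratr_int.
have Ninj (c : 'rV[R]_(\dim B)) : c *m map_mx intr N = 0 -> c = 0.
  rewrite mulmx_sum_row => c0.
  have /freeP Xfree : free (Tuple szX) by exact: (basis_free sB).
  apply/rowP => i; rewrite mxE.
  have [nz _] := fP s`_i.
  have /eqP : c 0 i * (f s`_i).1%:~R = 0.
    apply: (Xfree (fun i => c 0 i * (f s`_i).1%:~R)).
    by rewrite -[RHS]c0; apply: eq_bigr => r _; rewrite rN scalerA.
  by rewrite mulf_eq0 intr_eq0 (negbTE nz) orbF => /eqP.
exists N; split => //; apply/esym/eqP; rewrite eqEdim dim_rowv // leqnn andbT.
apply: rowv_sub => i; rewrite rN; apply: rpredZ.
by apply: (basis_mem sB); rewrite mem_nth // (eqP szX).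
Qed.

(** Take the Smith form N = L D Q of an integer matrix whose rows span [B] over the
    reals. The first rows of Q span the same real subspace, and since all rows of Q
    form a Z-basis of Z^n, an integer point of [B] has integer coordinates on them. *)
Lemma Zbasis_exists (R : realType) (n : nat) (B : {vspace 'rV[R]_n}) :
  is_rational B -> exists M : 'M[int]_(\dim B, n), is_Zbasis B M.
Proof.
move=> /rational_int_basis[N [Ninj BN]].
have inB v : (v \in B) = (v \in rowv (map_mx intr N)) by rewrite -BN.
have eNn : (\dim B <= n)%N by rewrite (leq_trans (dimvS (subvf B))) // dimvf dim_matrix [X in
  (X <= _)%N]mul1r.
have [L L_unit [Q Q_unit [ds _ NE]]] := int_Smith_normal_form N.
pose f := widen_ord eNn; pose M := rowsub f Q.
set Dg : 'M[int]_(\dim B, n) := \matrix_(_, _) _ in NE.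
have DgE : invmx L *m N = Dg *m Q by rewrite NE -mulmxA mulKmx.
have rowDg (i : 'I_(\dim B)) : row i (Dg *m Q) = ds`_i *: row i M.
  rewrite row_mul; apply/rowP => j; rewrite !mxE (bigD1 (f i)) //= big1 ?addr0.
    by rewrite !mxE eqxx mulr1n.
  move=> r rf; rewrite !mxE.
  case: eqP => [ir|_]; last by rewrite mulr0n mul0r.
  by case/eqP: rf; apply: val_inj; rewrite /= -ir.
have ds0 (i : 'I_(\dim B)) : ds`_i != 0.
  apply/eqP => di0.
  have := rowDg i; rewrite di0 scale0r -DgE row_mul => /(congr1 (map_mx (intr : int -> R))).
  rewrite map_mxM map_mx0 => /Ninj /(congr1 (fun v => v *m map_mx intr L)).
  rewrite mul0mx -map_mxM -row_mul mulVmx // => /rowP/(_ i).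
  by rewrite !mxE eqxx => /eqP; rewrite oner_eq0.
exists M; split.
- move=> i.
  have : map_mx intr (row i (invmx L *m N)) \in B.
    by rewrite row_mul map_mxM inB; apply/rowvP; eexists.
  rewrite DgE rowDg map_mxZ => /(rpredZ ((ds`_i)%:~R^-1)).
  by rewrite scalerA mulVf ?intr_eq0 // scale1r.
- move=> c1 c2 /= cM.
  have : (c1 *m rowsub f 1%:M) *m Q = (c2 *m rowsub f 1%:M) *m Q.
    by rewrite -!mulmxA -rowsubE.
  move/(can_inj (mulmxK Q_unit)) => cc; apply/rowP => i.
  have cE (c : 'rV[int]_(\dim B)) : (c *m rowsub f 1%:M) 0 (f i) = c 0 i.
    rewrite mxE (bigD1 i) //= big1 ?addr0 => [|r ri]; first by rewrite !mxE eqxx mulr1.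
    rewrite !mxE; case: eqP => [/(congr1 val) /= rE|_]; last by rewrite mulr0.
    by case/eqP: ri; exact: val_inj.
  by rewrite -!cE cc.
- move=> v; rewrite inB => /rowvP[c vE].
  pose w := v *m invmx Q.
  have wE : map_mx intr w = c *m map_mx intr L *m map_mx intr Dg.
    rewrite /w map_mxM vE NE !map_mxM -!mulmxA.
    rewrite -[X in _ *m (_ *m (_ *m X))]map_mxM mulmxV // map_mx1 mulmx1.
    by [].
  have w0 (j : 'I_n) : (\dim B <= j)%N -> w 0 j = 0.
    move=> ej; apply/eqP; rewrite -(intr_eq0 R); apply/eqP.
    have /rowP/(_ j) := wE; rewrite mxE => ->.
    rewrite mxE big1 // => i _; rewrite !mxE.
    case: eqP => [ij|_]; last by rewrite mulr0n mulr0.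
    by have := ltn_ord i; rewrite ij ltnNge ej.
  exists (\row_i w 0 (f i)).
  have -> : v = w *m Q by rewrite mulmxKV.
  apply/rowP => j; rewrite !mxE.
  rewrite [LHS](bigID (fun i : 'I_n => (i < \dim B)%N)) /= [X in _ + X]big1 ?addr0.
    rewrite (big_ord_narrow eNn); apply: eq_bigr => i _; by rewrite !mxE.
  by move=> i; rewrite -leqNgt => /w0 ->; rewrite mul0r.
Qed.

(** Heights are always accessed through this list of properties of the Z-basis
    selected in their definition. *)
Lemma height_Zbasis (R : realType) (n : nat) (B : {vspace 'rV[R]_n}) :
  is_rational B -> exists M : 'M[int]_(\dim B, n),
    [/\ height B = wedge_norm (map_mx intr M : 'M[R]_(\dim B, n)),
        B = rowv (map_mx intr M),
        forall c : 'rV[R]_(\dim B), c *m map_mx intr M = 0 -> c = 0 &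
        forall m (U : 'M[int]_(m, n)), (forall i, map_mx intr (row i U) \in B) ->
          exists T : 'M[int]_(m, \dim B), U = T *m M].
Proof.
move=> ratB; have [M0 M0B] := Zbasis_exists ratB.
pose M := xget 0 [set M : 'M[int]_(\dim B, n) | is_Zbasis B M].
have [MB _ MZ] : is_Zbasis B M.
  have : [set M : 'M[int]_(\dim B, n) | is_Zbasis B M] M0 by [].
  by move/(@xgetI _ 0).
have MT m (U : 'M[int]_(m, n)) : (forall i, map_mx intr (row i U) \in B) ->
    exists T : 'M[int]_(m, \dim B), U = T *m M.
  move=> UB; have /choice[t tE] : forall i, exists c : 'rV_(\dim B), row i U = c *m M.
    by move=> i; apply: MZ.
  exists (\matrix_i t i); apply/row_matrixP => i.
  by rewrite row_mul rowK -tE.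
have [N [Ninj BN]] := rational_int_basis ratB.
have inB v : (v \in B) = (v \in rowv (map_mx intr N)) by rewrite -BN.
have [i|T NT] := MT _ N.
  by rewrite inB map_row; exact: row_in_rowv.
have BM : B = rowv (map_mx intr M).
  apply/eqP; rewrite eqEsubv; apply/andP; split; last first.
    by apply: rowv_sub => i; rewrite -map_row.
  apply/subvP => v; rewrite inB => /rowvP[c ->]; apply/rowvP.
  by exists (c *m map_mx intr T); rewrite -mulmxA -map_mxM -NT.
exists M; split => // c cM.
have T_unit : map_mx intr T \in (unitmx : pred 'M[R]_(\dim B)).
  rewrite -row_free_unit -kermx_eq0; apply/eqP/row_matrixP => i; rewrite row0.
  apply: Ninj; rewrite NT map_mxM mulmxA -row_mul mulmx_ker row0 mul0mx //.
rewrite -[c](mulmxKV T_unit).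
suff -> : c *m invmx (map_mx intr T) = 0 by rewrite mul0mx.
by apply: Ninj; rewrite NT map_mxM mulmxA mulmxKV.
Qed.

Lemma det_colsub_inj (K : comNzRingType) (e n : nat) (M : 'M[K]_(e, n))
    (s : 'I_e -> 'I_n) : \det (colsub s M) != 0 -> injective s.
Proof.
move=> D0; apply/injectiveP; apply: contraNT D0 => /injectivePn[i [j ij sij]].
rewrite -det_tr (determinant_alternate ij) // => l.
by rewrite !mxE sij.
Qed.

(** Cramer's rule for the square submatrix on the columns [s]. *)
Lemma adj_colsub_mul (K : comPzRingType) (e n : nat) (M : 'M[K]_(e, n))
    (s : 'I_e -> 'I_n) (r : 'I_e) (j : 'I_n) :
  (\adj (colsub s M) *m M) r j =
  \det (colsub (fun i => if i == r then j else s i) M).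
Proof.
rewrite (expand_det_col _ r) mxE; apply: eq_bigr => t _.
rewrite !mxE eqxx mulrC; congr (_ * _).
rewrite /cofactor; congr (_ * \det _); apply/matrixP => a b; rewrite !mxE.
by rewrite eq_sym (negbTE (neq_lift _ _)).
Qed.

(** If the minor of [M] on [s] is nonzero, the coordinates of a vector of the row
    space are determined by those with index in [s]. The columns of this matrix are these
      linear relations, multiplied by
    that minor; by Cramer's rule their coefficients are minors of [M] too. *)
Definition kernel_form (e n : nat) (s : 'I_e -> 'I_n) (M : 'M[int]_(e, n)) : 'M[int]_n :=
  (\det (colsub s M))%:M - colsub s 1%:M *m (\adj (colsub s M) *m M).

Section KernelForm.
Variables (R : realType) (e n : nat) (s : 'I_e -> 'I_n) (M : 'M[int]_(e, n)).
Hypothesis D0 : \det (colsub s M) != 0.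

Let MR : 'M[R]_(e, n) := map_mx intr M.

Let minorR (t : 'I_e -> 'I_n) : (\det (colsub t M))%:~R = \det (colsub t MR).
Proof. by rewrite -det_map_mx map_mxsub. Qed.

Lemma kernel_form_le i j :
  `|(kernel_form s M i j)%:~R : R| <= 2 * wedge_norm MR.
Proof.
have s_inj := det_colsub_inj D0.
rewrite !mxE intrB (le_trans (ler_normB _ _)) // mulrDl mul1r lerD //.
  case: (i == j); rewrite ?mulr1n ?mulr0n ?normr0 ?sqrtr_ge0 //.
  by rewrite minorR minor_le_wedge_norm.
have [[r ir]|nr] := pselect (exists r, i = s r).
  rewrite (bigD1 r) //= big1 ?addr0 => [|t tr]; last first.
    rewrite !mxE ir; case: eqP => [/s_inj rt|_]; last by rewrite mul0r.
    by rewrite rt eqxx in tr.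
  by rewrite adj_colsub_mul !mxE ir eqxx mul1r minorR minor_le_wedge_norm.
rewrite big1 ?normr0 ?sqrtr_ge0 // => r _; rewrite !mxE.
by case: eqP => [ir|_]; rewrite ?mul0r //; case: nr; exists r.
Qed.

Lemma kernel_formP v : (v \in rowv MR) = (v *m map_mx intr (kernel_form s M) == 0).
Proof.
have vS (w : 'rV[R]_n) : w *m colsub s 1%:M = colsub s w.
  by rewrite mulmx_colsub mulmx1.
have GE : map_mx intr (kernel_form s M) =
    (\det (colsub s MR))%:M - colsub s 1%:M *m (\adj (colsub s MR) *m MR).
  rewrite /kernel_form map_mxB map_scalar_mx /= minorR !map_mxM map_mxsub map_mx1.
  by rewrite map_mx_adj map_mxsub.
have DR : \det (colsub s MR) != 0 by rewrite -minorR intr_eq0.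
rewrite GE mulmxBr mul_mx_scalar !mulmxA vS -mulmxA subr_eq0.
apply/rowvP/eqP => [[c ->]|vE].
  rewrite -mulmx_colsub -mulmxA (mulmxA (colsub s MR)) mul_mx_adj mul_scalar_mx.
  by rewrite scalemxAr.
exists ((\det (colsub s MR))^-1 *: (colsub s v *m \adj (colsub s MR))).
by rewrite -scalemxAl -mulmxA -vE scalerA mulVf // scale1r.
Qed.

End KernelForm.

Section Height.
Variables (R : realType) (n : nat).
Implicit Types B : {vspace 'rV[R]_n}.

Lemma intr_row_free_minor (e : nat) (M : 'M[int]_(e, n)) :
  (forall c : 'rV[R]_e, c *m map_mx intr M = 0 -> c = 0) ->
  exists s : 'I_e -> 'I_n, \det (colsub s M) != 0.
Proof.
move=> Minj.
have : row_free (map_mx intr M : 'M[R]_(e, n)).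
  rewrite -kermx_eq0; apply/eqP/row_matrixP => i; rewrite row0; apply: Minj.
  by rewrite -row_mul mulmx_ker row0.
move=> /row_free_minor[s D0]; exists s; apply: contraNneq D0 => D0.
by rewrite -map_mxsub det_map_mx D0.
Qed.

(** A rational subspace is thus the kernel of an integer matrix that its height
    bounds: an integer point outside of [B] is sent to a nonzero integer vector,
    hence stays away from [B]. *)
Lemma height_kernel B : is_rational B ->
  exists G : 'M[int]_n,
    (forall i j, `|(G i j)%:~R : R| <= 2 * height B) /\
    (forall v, (v \in B) = (v *m map_mx intr G == 0)).
Proof.
move=> /height_Zbasis[M [-> BM Minj _]].
have [s D0] := intr_row_free_minor Minj.
exists (kernel_form s M); split=> [i j|v]; first exact: kernel_form_le.
have -> : (v \in B) = (v \in rowv (map_mx intr M)) by rewrite -BM.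
exact: kernel_formP.
Qed.

Lemma height_ge1 B : is_rational B -> 1 <= height B.
Proof.
move=> /height_Zbasis[M [-> BM Minj _]].
have [s D0] := intr_row_free_minor Minj.
apply: le_trans (minor_le_wedge_norm _ s).
rewrite -map_mxsub det_map_mx -intr_norm -[1]/(1%:~R) ler_int.
by rewrite -gtz0_ge1 normr_gt0.
Qed.

(** Such a subspace is the kernel of an integer matrix with bounded entries, and
    there are finitely many of these. *)
Lemma height_finite (b : R) :
  finite_set [set B : {vspace 'rV[R]_n} | is_rational B /\ height B <= b].
Proof.
pose N := Num.truncn `|2 * b|.
pose dec (i : 'I_(N.+1 + N.+1)) : int := (i : nat)%:Z - N.+1%:Z.
pose W (f : {ffun 'I_n * 'I_n -> 'I_(N.+1 + N.+1)}) : {vspace 'rV[R]_n} :=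
  lker (linfun (mulmxr (map_mx intr (\matrix_(i, j) dec (f (i, j)))) :
                  'rV[R]_n -> 'rV[R]_n)).
apply: (@sub_finite_set _ _ (range W)); last first.
  by apply: finite_image; exact: finite_finset.
move=> B [/height_kernel[G [Gb BG]] hB].
have Gsmall i j : `|G i j| <= N%:Z.
  have : `|(G i j)%:~R : R| <= `|2 * b|.
    rewrite (le_trans (Gb i j)) // (le_trans _ (ler_norm _)) //.
    by rewrite ler_pM2l.
  rewrite -intr_norm -[`|G i j|]gez0_abs // -pmulrn => H.
  rewrite lez_nat /N truncn_ge_nat //.
have decP i j : (absz (G i j + N.+1%:Z)%R < N.+1 + N.+1)%N by have := Gsmall i j; lia.
exists [ffun p => Ordinal (decP p.1 p.2)] => //.
apply/vspaceP => v; rewrite memv_ker lfunE /= BG; congr (_ *m _ == 0).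
apply/matrixP => i j; rewrite !mxE ffunE /dec /=; congr (_%:~R).
by have := Gsmall i j; lia.
Qed.

Lemma rational_rowv (e : nat) (U : 'M[int]_(e, n)) :
  (forall c : 'rV[R]_e, c *m map_mx intr U = 0 -> c = 0) ->
  rational_subspaces R n e (rowv (map_mx intr U)).
Proof.
move=> Uinj; split; first exact: dim_rowv.
exists [seq map_mx intr (row i U) | i <- enum 'I_e].
have -> : [seq map_mx (ratr : rat -> R) v | v <- [seq map_mx intr (row i U) | i <- enum 'I_e]]
    = [seq row i (map_mx intr U) | i <- enum 'I_e].
  rewrite -map_comp; apply: eq_map => i /=.
  by apply/rowP => j; rewrite !mxE ratr_int.
rewrite basisEdim -rowv_span subvv /= dim_rowv // size_map.
by rewrite -cardE card_ord.
Qed.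

End Height.

(** * The angle between two subspaces *)

Lemma det_mx22 (K : comNzRingType) (M : 'M[K]_(1 + 1)) :
  \det M = M ord0 ord0 * M ord_max ord_max - M ord0 ord_max * M ord_max ord0.
Proof.
rewrite (expand_det_row _ ord0) !big_ord_recl big_ord0 addr0 /cofactor.
rewrite !det_mx11 !mxE /= /bump /= addn0 expr0 expr1.
have -> : lift ord0 (0 : 'I_1) = ord_max :> 'I_(1 + 1) by exact: val_inj.
have -> : lift (ord_max : 'I_(1 + 1)) (0 : 'I_1) = ord0 by exact: val_inj.
by rewrite mul1r mulN1r mulrN.
Qed.

Lemma det_colsub_pair (K : comNzRingType) (n : nat) (X Y : 'rV[K]_n)
    (s : 'I_(1 + 1) -> 'I_n) :
  \det (colsub s (col_mx X Y)) =
  X 0 (s ord0) * Y 0 (s ord_max) - X 0 (s ord_max) * Y 0 (s ord0).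
Proof.
have E0 j : col_mx X Y ord0 j = X 0 j.
  by rewrite -(col_mxEu X Y); congr (col_mx _ _ _ _); exact: val_inj.
have E1 j : col_mx X Y ord_max j = Y 0 j.
  by rewrite -(col_mxEd X Y); congr (col_mx _ _ _ _); exact: val_inj.
by rewrite det_mx22 ![colsub _ _ _ _]mxE !E0 !E1.
Qed.

Section Omega.
Variables (R : realType) (n : nat).
Implicit Types (X Y : 'rV[R]_n) (A B : {vspace 'rV[R]_n}).

Lemma dotv_ge0 X : 0 <= dotv X X.
Proof. by apply: sumr_ge0 => i _; rewrite -expr2 sqr_ge0. Qed.

Lemma enorm_ge0 X : 0 <= enorm X. Proof. exact: sqrtr_ge0. Qed.

Lemma coord_le_enorm X i : `|X 0 i| <= enorm X.
Proof.
rewrite -sqrtr_sqr; apply: ler_wsqrtr; rewrite /dotv (bigD1 i) //= -expr2.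
by rewrite lerDl sumr_ge0 // => j _; rewrite -expr2 sqr_ge0.
Qed.

Lemma enorm_le X b : 0 <= b -> (forall i, `|X 0 i| <= b) -> enorm X <= n%:R * b.
Proof.
move=> b0 Xb; rewrite -[leRHS]ger0_norm ?mulr_ge0 // -sqrtr_sqr; apply: ler_wsqrtr.
apply: (@le_trans _ _ (\sum_(i < n) b ^+ 2)).
  apply: ler_sum => i _; rewrite -expr2 -real_normK ?num_real //.
  by rewrite lerXn2r ?nnegrE.
rewrite sumr_const card_ord -[leLHS]mulr_natl exprMn.
apply: ler_wpM2r; rewrite ?sqr_ge0 // -natrX ler_nat.
by case: n => // m; rewrite -mulnn leq_pmulr.
Qed.

Lemma enorm_gt0 X : X != 0 -> 0 < enorm X.
Proof.
move=> X0; rewrite lt_def enorm_ge0 andbT; apply: contraNneq X0 => X0.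
apply/eqP/rowP => i; rewrite mxE; apply/eqP; rewrite -normr_le0 -X0.
exact: coord_le_enorm.
Qed.

Lemma enormZ a X : enorm (a *: X) = `|a| * enorm X.
Proof.
rewrite /enorm -sqrtr_sqr -sqrtrM ?sqr_ge0 // /dotv mulr_sumr.
by congr Num.sqrt; apply: eq_bigr => i _; rewrite !mxE; ring.
Qed.

Lemma pair_minor_le X Y i j :
  `|X 0 i * Y 0 j - X 0 j * Y 0 i| <= wedge_norm (col_mx X Y).
Proof.
pose s (r : 'I_(1 + 1)) := if r == ord0 then i else j.
by have := minor_le_wedge_norm (col_mx X Y) s; rewrite det_colsub_pair /s /=.
Qed.

Lemma exists_max_coord (m : nat) (Y : 'rV[R]_m) :
  Y != 0 -> exists i, forall j, `|Y 0 j| <= `|Y 0 i|.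
Proof.
move=> Y0; have [i0 _] : exists i, Y 0 i != 0.
  by apply/existsP; apply: contraNT Y0 => /existsPn Y0; apply/eqP/rowP => i;
     rewrite mxE; apply/eqP; have := Y0 i; rewrite negbK.
exists [arg max_(i > i0) `|Y 0 i|]%O; case: arg_maxP => // i _ iM j.
exact: iM.
Qed.

(** Up to a constant factor, [omega X Y] is the relative distance from [X] to the
    line spanned by [Y]: this lemma and [omega_le] are the two halves of that
    comparison. The multiple of [Y] is chosen to agree with [X] on the largest
    coordinate of [Y]. *)
Lemma omega_approx X Y : X != 0 -> Y != 0 ->
  exists l : R, forall j, `|X 0 j - l * Y 0 j| <= n%:R * omega X Y * enorm X.
Proof.
move=> X0 Y0; have [i iM] := exists_max_coord Y0.
have Yn : enorm Y <= n%:R * `|Y 0 i| by apply: enorm_le.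
have eY := enorm_gt0 Y0; have eX := enorm_gt0 X0.
have Yi : 0 < `|Y 0 i|.
  by rewrite lt_def normr_ge0 andbT; apply: contraTneq Yn => ->; rewrite mulr0 -ltNge.
exists (X 0 i / Y 0 i) => j.
have -> : X 0 j - X 0 i / Y 0 i * Y 0 j = (X 0 j * Y 0 i - X 0 i * Y 0 j) / Y 0 i.
  by field; rewrite -normr_gt0.
rewrite normrM normfV ler_pdivrMr //.
apply: le_trans (pair_minor_le X Y j i) _.
have -> : wedge_norm (col_mx X Y) = omega X Y * enorm X * enorm Y.
  by rewrite /omega; field; rewrite !gt_eqF.
have -> : n%:R * omega X Y * enorm X * `|Y 0 i| = omega X Y * enorm X * (n%:R * `|Y 0 i|) by ring.
by rewrite ler_wpM2l // mulr_ge0 ?enorm_ge0 // divr_ge0 ?sqrtr_ge0 // mulr_ge0 ?enorm_ge0.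
Qed.

Lemma omega_le X Y b : 0 <= b -> X != 0 -> Y != 0 ->
  (forall j, `|X 0 j - Y 0 j| <= b) ->
  omega X Y <= (n ^ 2)%N%:R * 2 * b / enorm X.
Proof.
move=> b0 X0 Y0 XYb; have eY := enorm_gt0 Y0; have eX := enorm_gt0 X0.
rewrite /omega ler_pdivrMr ?mulr_gt0 //.
have -> : (n ^ 2)%N%:R * 2 * b / enorm X * (enorm X * enorm Y) =
   (n ^ 2)%N%:R * (2 * b * enorm Y) by field; rewrite gt_eqF.
apply: wedge_norm_le => [|s]; first by rewrite !mulr_ge0 ?enorm_ge0.
rewrite det_colsub_pair.
have -> : X 0 (s ord0) * Y 0 (s ord_max) - X 0 (s ord_max) * Y 0 (s ord0) =
  (X 0 (s ord0) - Y 0 (s ord0)) * Y 0 (s ord_max) -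
  (X 0 (s ord_max) - Y 0 (s ord_max)) * Y 0 (s ord0) by ring.
apply: le_trans (ler_normB _ _) _.
have -> : 2 * b * enorm Y = b * enorm Y + b * enorm Y by ring.
by rewrite !normrM; apply: lerD; apply: ler_pM; rewrite // coord_le_enorm.
Qed.

Lemma omegaZ a b X Y : 0 < a -> 0 < b -> omega (a *: X) (b *: Y) = omega X Y.
Proof.
move=> a0 b0; rewrite /omega !enormZ !gtr0_norm //.
have -> : wedge_norm (col_mx (a *: X) (b *: Y)) = a * b * wedge_norm (col_mx X Y).
  have ab0 : 0 <= a * b by rewrite mulr_ge0 ?ltW.
  rewrite /wedge_norm -[a * b]ger0_norm // -sqrtr_sqr -sqrtrM ?sqr_ge0 // mulr_sumr.
  congr Num.sqrt; apply: eq_bigr => s _.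
  by rewrite !det_colsub_pair !mxE; ring.
have ab : a * b != 0 by rewrite gt_eqF ?mulr_gt0.
rewrite (_ : a * enorm X * (b * enorm Y) = a * b * (enorm X * enorm Y)); last by ring.
by rewrite -mulf_div divff // mul1r.
Qed.

(** Makes membership in a subspace a closed condition. *)
Lemma vspace_kernel A : exists G : 'M[R]_n, forall X, (X \in A) = (X *m G == 0).
Proof.
exists (lin1_mx (\1 - projv A)%VF) => X; rewrite mul_rV_lin1 /=.
rewrite add_lfunE opp_lfunE id_lfunE subr_eq0; apply/idP/eqP => [XA|->].
  by rewrite projv_id.
exact: memv_proj.
Qed.

End Omega.

Section Minimizer.
Variables (R : realType) (n : nat).
Implicit Types (X Y : 'rV[R]_n) (A B : {vspace 'rV[R]_n}).

Lemma continuous_sum (T : topologicalType) (I : Type) (r : seq I) (P : pred I)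
    (f : I -> T -> R) :
  (forall i, P i -> continuous (f i)) -> continuous (fun x => \sum_(i <- r | P i) f i x).
Proof. by move=> fc; apply: continuous_big => //; exact: add_continuous. Qed.

Lemma continuous_mul (T : topologicalType) (f g : T -> R) :
  continuous f -> continuous g -> continuous (fun x => f x * g x).
Proof. by move=> fc gc x; exact: (continuousM (fc x) (gc x)). Qed.

Lemma continuous_sub (T : topologicalType) (f g : T -> R) :
  continuous f -> continuous g -> continuous (fun x => f x - g x).
Proof. by move=> fc gc x; exact: (continuousB (fc x) (gc x)). Qed.

Lemma continuous_wedge_pair :
  continuous (fun Z : 'rV[R]_(n + n) => wedge_norm (col_mx (lsubmx Z) (rsubmx Z))).
Proof.
have subc i : continuous (fun Z : 'rV[R]_(n + n) => Z 0 i) by move=> Z; exact: coord_continuous.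
move=> Z; rewrite /wedge_norm.
apply: (@continuous_comp _ _ _ (fun Z : 'rV[R]_(n + n) =>
   \sum_(s : {ffun 'I_(1 + 1) -> 'I_n} | strictly_increasing s)
     \det (colsub s (col_mx (lsubmx Z) (rsubmx Z))) ^+ 2) Num.sqrt);
  last exact: sqrt_continuous.
apply: continuous_sum => s _.
under eq_fun do rewrite det_colsub_pair !mxE expr2.
by apply: continuous_mul; apply: continuous_sub; apply: continuous_mul; exact: subc.
Qed.

Lemma closed_pairs A B :
  closed [set Z : 'rV[R]_(n + n) | [/\ lsubmx Z \in A, rsubmx Z \in B,
    dotv (lsubmx Z) (lsubmx Z) = 1 & dotv (rsubmx Z) (rsubmx Z) = 1]].
Proof.
have subc i : continuous (fun Z : 'rV[R]_(n + n) => Z 0 i) by move=> Z; exact: coord_continuous.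
have eqc (f : 'rV[R]_(n + n) -> R) c : continuous f -> closed [set Z | f Z = c].
  move=> fc; apply: (@preimage_closed _ _ f [set x | x = c]).
    by move=> x _; exact: fc.
  exact: closed_eq.
have vsc (W : {vspace 'rV[R]_n}) (g : 'rV[R]_(n + n) -> 'rV[R]_n) :
    (forall i, continuous (fun Z => g Z 0 i)) -> closed [set Z | g Z \in W].
  move=> gc; have [G GW] := vspace_kernel W.
  have -> : [set Z | g Z \in W] =
      \bigcap_(j in [set: 'I_n]) [set Z | \sum_i g Z 0 i * G i j = 0].
    apply/seteqP; split => Z /=; rewrite GW.
      by move=> /eqP/rowP ZG j _ /=; have := ZG j; rewrite !mxE.
    by move=> ZG; apply/eqP/rowP => j; rewrite !mxE; exact: ZG.
  apply: closed_bigI => j _; apply: eqc; apply: continuous_sum => i _.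
  by apply: continuous_mul; [exact: gc|exact: cst_continuous].
have dotc (g : 'rV[R]_(n + n) -> 'rV[R]_n) :
    (forall i, continuous (fun Z => g Z 0 i)) -> closed [set Z | dotv (g Z) (g Z) = 1].
  move=> gc; apply: eqc; apply: continuous_sum => i _.
  by apply: continuous_mul; exact: gc.
have lc i : continuous (fun Z : 'rV[R]_(n + n) => (lsubmx Z : 'rV[R]_n) 0 i).
  by under eq_fun do rewrite mxE; exact: subc.
have rc i : continuous (fun Z : 'rV[R]_(n + n) => (rsubmx Z : 'rV[R]_n) 0 i).
  by under eq_fun do rewrite mxE; exact: subc.
have -> : [set Z : 'rV[R]_(n + n) | [/\ lsubmx Z \in A, rsubmx Z \in B,
    dotv (lsubmx Z) (lsubmx Z) = 1 & dotv (rsubmx Z) (rsubmx Z) = 1]] =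
  ([set Z : 'rV[R]_(n + n) | (lsubmx Z : 'rV[R]_n) \in A] `&`
   [set Z : 'rV[R]_(n + n) | (rsubmx Z : 'rV[R]_n) \in B]) `&`
  ([set Z : 'rV[R]_(n + n) | dotv (lsubmx Z) (lsubmx Z) = 1] `&`
   [set Z : 'rV[R]_(n + n) | dotv (rsubmx Z) (rsubmx Z) = 1]).
  by apply/seteqP; split => Z /= => [[]|[[]? ? []]] //.
by apply: closedI; apply: closedI; [exact: vsc|exact: vsc|exact: dotc|exact: dotc].
Qed.

(** [omega] is invariant under scaling and continuous on the compact set of pairs
    of unit vectors. *)
Lemma omega_minimizer_exists A B : (0 < \dim A)%N -> (0 < \dim B)%N ->
  exists p, omega_minimizer (orthogonal_in A [::]) (orthogonal_in B [::]) p.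
Proof.
move=> dA dB.
have orth0 (W : {vspace 'rV[R]_n}) X : orthogonal_in W [::] X <-> X \in W.
  split=> [[]//|XW]; split => // Y; rewrite span_nil memv0 => /eqP ->.
  by rewrite /dotv big1 // => i _; rewrite mxE mulr0.
pose K := [set Z : 'rV[R]_(n + n) | [/\ lsubmx Z \in A, rsubmx Z \in B,
    dotv (lsubmx Z) (lsubmx Z) = 1 & dotv (rsubmx Z) (rsubmx Z) = 1]].
have dot1 X : dotv X X = 1 -> enorm X = 1 by rewrite /enorm => ->; rewrite sqrtr1.
have unitK X : X != 0 -> dotv ((enorm X)^-1 *: X) ((enorm X)^-1 *: X) = 1.
  move=> /enorm_gt0 X0; rewrite -[LHS]sqr_sqrtr ?dotv_ge0 // -/(enorm _).
  rewrite enormZ normfV ger0_norm ?ltW // mulVf ?gt_eqF // expr1n //.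
have inK X Y : X \in A -> X != 0 -> Y \in B -> Y != 0 ->
    K (row_mx ((enorm X)^-1 *: X) ((enorm Y)^-1 *: Y)).
  by move=> XA X0 YB Y0; rewrite /K /= !row_mxKl !row_mxKr !unitK // !memvZ.
have K0 : K !=set0.
  have dimn0 (W : {vspace 'rV[R]_n}) : (0 < \dim W)%N -> exists2 X, X \in W & X != 0.
    move=> dW; exists (vpick W); rewrite ?memv_pick // vpick0.
    by rewrite -dimv_eq0 -lt0n.
  have [X XA X0] := dimn0 A dA; have [Y YB Y0] := dimn0 B dB.
  by eexists; exact: inK XA X0 YB Y0.
have Kcompact : compact K.
  apply: bounded_closed_compact; last exact: closed_pairs.
  exists 1; split; first exact: num_real.
  move=> x x1 Z [_ _ l1 r1] /=; apply: le_trans (ltW x1).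
  rewrite [leLHS]/Num.Def.normr /= mx_normrE; apply/bigmax_leP; split => //= -[i j] _ /=.
  rewrite ord1 -[j]splitK; case: (fintype.split j) => k /=.
    by have := coord_le_enorm (lsubmx Z) k; rewrite dot1 // mxE.
  by have := coord_le_enorm (rsubmx Z) k; rewrite dot1 // mxE.
have [Z ZK Zmin] := EVT_min_rV K0 Kcompact (continuous_subspaceT continuous_wedge_pair).
have [ZA ZB l1 r1] := set_mem ZK.
have n0 X : dotv X X = 1 -> X != 0.
  move=> X1; apply/eqP => X0; move: X1; rewrite X0 /dotv big1 => [/eqP|i _];
    last by rewrite mxE mul0r.
  by rewrite eq_sym oner_eq0.
exists (lsubmx Z, rsubmx Z); split => /=; try exact/orth0; try exact: n0.
move=> X Y /orth0 XA X0 /orth0 YB Y0.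
have eX := enorm_gt0 X0; have eY := enorm_gt0 Y0.
have /mem_set/Zmin := inK X Y XA X0 YB Y0; rewrite row_mxKl row_mxKr => H.
rewrite -[leRHS](@omegaZ _ _ (enorm X)^-1 (enorm Y)^-1) ?invr_gt0 //.
by rewrite /omega (dot1 _ l1) (dot1 _ r1) (dot1 _ (unitK _ X0)) (dot1 _ (unitK _ Y0)) !mulr1 !divr1.
Qed.

(** In these dimensions the shift by [gdim] vanishes and the first step of the
    induction has no orthogonality constraint, so psi is a plain minimum. *)
Lemma psi1P A B : (0 < \dim A)%N -> (0 < \dim B)%N -> (\dim A + \dim B <= n)%N ->
  (exists X Y, [/\ X \in A, X != 0, Y \in B, Y != 0 & psi 1 A B = omega X Y]) /\
  (forall X Y, X \in A -> X != 0 -> Y \in B -> Y != 0 -> psi 1 A B <= omega X Y).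
Proof.
move=> dA dB dn; rewrite /psi /gdim.
have -> : (1 + (\dim A + \dim B - n) = 1)%N by move: dn; rewrite -subn_eq0 => /eqP ->.
rewrite /omega_ /=.
have [p0 p0min] := omega_minimizer_exists dA dB.
set P := [set p | _].
have : P p0 by exact: p0min.
move=> /(xgetI (0, 0)); set p := xget _ _; case=> -[pA _] p10 [pB _] p20 pmin.
split; first by exists p.1, p.2.
move=> X Y XA X0 YB Y0; apply: pmin => //; split=> // W; rewrite span_nil memv0 => /eqP ->.
  by rewrite /dotv big1 // => i _; rewrite mxE mulr0.
by rewrite /dotv big1 // => i _; rewrite mxE mulr0.
Qed.

End Minimizer.

(** * Liouville's inequality for roots of two *)

Definition root2 (R : realType) (m : nat) : R := 2 `^ (m.+1%:R^-1).

Lemma root2X (R : realType) m : root2 R m ^+ m.+1 = 2.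
Proof. by rewrite /root2 -powR_mulrn ?powR_ge0 // -powRrM mulVf ?pnatr_eq0 // powRr1. Qed.

Lemma root2_gt1 (R : realType) m : 1 < root2 R m.
Proof.
rewrite ltNge; apply/negP => a1.
have : root2 R m ^+ m.+1 <= 1 by rewrite exprn_ile1 // powR_ge0.
by rewrite root2X; lra.
Qed.

(** The companion matrix of X^(m+1) - 2, that is, multiplication by [root2] in the
    basis of its first powers. *)
Definition root2_mx m : 'M[int]_m.+1 :=
  \matrix_(i, j) (if i == ord_max then 2 * (j == 0)%:R else (j == i.+1 :> nat)%:R).

Lemma row_root2_mx m (i : 'I_m.+1) :
  delta_mx 0 i *m root2_mx m =
  if i == ord_max then 2 *: delta_mx 0 0 else delta_mx 0 (inord i.+1) :> 'rV_m.+1.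
Proof.
rewrite -rowE; apply/rowP => j; rewrite !mxE.
case: ifP => [_|/negbT im]; rewrite !mxE //=.
congr (_%:R); congr nat_of_bool; apply/eqP/eqP => [ji|->].
  by apply: val_inj; rewrite /= inordK -?ji.
rewrite inordK // ltnS ltn_neqAle -ltnS ltn_ord andbT.
by apply: contraNneq im => im; apply/eqP; apply: val_inj.
Qed.

Lemma row0_root2_mxX m t (tm : (t < m.+1)%N) :
  delta_mx 0 0 *m root2_mx m ^+ t = delta_mx 0 (Ordinal tm) :> 'rV_m.+1.
Proof.
elim: t tm => [|t IH] tm; first by rewrite expr0 mulmx1; congr delta_mx; exact: val_inj.
rewrite exprSr mulmxA (IH (ltnW tm)) row_root2_mx ifN.
  by congr delta_mx; apply: val_inj; rewrite /= inordK.
by apply/eqP => /(congr1 val) /= E; move: tm; rewrite E ltnn.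
Qed.

Lemma root2_mxX m : root2_mx m ^+ m.+1 = 2%:M.
Proof.
apply/row_matrixP => i; rewrite !rowE.
have d0 : delta_mx 0 0 *m root2_mx m ^+ m.+1 = 2 *: delta_mx 0 0 :> 'rV_m.+1.
  rewrite exprSr mulmxA (row0_root2_mxX (ltnSn m)) row_root2_mx ifT //.
have -> : delta_mx 0 i = delta_mx 0 0 *m root2_mx m ^+ i :> 'rV_m.+1.
  by rewrite (row0_root2_mxX (ltn_ord i)); congr delta_mx; exact: val_inj.
rewrite -mulmxA -[_ *m root2_mx m ^+ m.+1]/(_ * _) -exprD addnC exprD mulmxA d0.
by rewrite -scalemxAl mul_mx_scalar.
Qed.

Lemma irreducible_Xn_sub2 m : irreducible_poly ('X^(m.+1) - 2%:P : {poly rat}).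
Proof.
have sz : size ('X^(m.+1) - 2%:P : {poly int}) = m.+2 by rewrite size_XnsubC.
have <- : map_poly intr ('X^(m.+1) - 2%:P : {poly int}) = 'X^(m.+1) - 2%:P :> {poly rat}.
  by rewrite rmorphB /= map_polyXn map_polyC.
apply/irreducible_rat_int/(@eisenstein_crit 2) => //.
- by rewrite sz.
- by rewrite (eqP (monicXnsubC _ _)).
- by rewrite !coefE /=.
- move=> i; rewrite sz /= => im.
  rewrite coefB coefXn coefC ltn_eqF // sub0r.
  by case: eqP.
Qed.

(** Multiplication by the sum of the v_t root2^t in the same basis. *)
Definition root2_mul_mx m (v : 'rV[int]_m.+1) : 'M[int]_m.+1 :=
  \sum_(t < m.+1) v 0 t *: root2_mx m ^+ t.

(** X^(m+1) - 2 is irreducible by Eisenstein's criterion, hence coprime to the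
    polynomial with coefficients [v]; a Bezout relation evaluated at the companion
    matrix gives an inverse over the rationals. *)
Lemma det_root2_mul_mx m (v : 'rV[int]_m.+1) : v != 0 -> \det (root2_mul_mx v) != 0.
Proof.
move=> v0.
pose Cq : 'M[rat]_m.+1 := map_mx intr (root2_mx m).
pose q : {poly rat} := \sum_(t < m.+1) (v 0 t)%:~R *: 'X^t.
have qE : horner_mx Cq q = map_mx intr (root2_mul_mx v).
  rewrite /q /root2_mul_mx rmorph_sum /= [RHS]rmorph_sum /=; apply: eq_bigr => t _.
  rewrite linearZ /= rmorphXn /= horner_mx_X map_mxZ; congr (_ *: _).
  by rewrite -[RHS]/(map_mx _ _) rmorphXn.
have qcoef (t : 'I_m.+1) : q`_t = (v 0 t)%:~R.
  rewrite /q coef_sum (bigD1 t) //= big1 ?addr0 => [|r rt].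
    by rewrite coefZ coefXn eqxx mulr1.
  rewrite coefZ coefXn; case: eqP => [E|_]; last by rewrite mulr0.
  by case/eqP: rt; apply: val_inj.
have q0 : q != 0.
  apply: contraNneq v0 => q0; apply/eqP/rowP => t; rewrite mxE; apply/eqP.
  by rewrite -(intr_eq0 rat) -qcoef q0 coef0.
have szq : (size q <= m.+1)%N.
  apply: (leq_trans (size_sum _ _ _)); apply/bigmax_leqP => t _.
  by rewrite (leq_trans (size_scale_leq _ _)) // size_polyXn.
have [_ irr] := irreducible_Xn_sub2 m.
have /Bezout_coprimepP[[a b] /= ab1] : coprimep q ('X^(m.+1) - 2%:P).
  rewrite /coprimep; apply: contraT => /irr/(_ (dvdp_gcdr _ _)) /eqp_size szg.
  have := leq_gcdpl ('X^(m.+1) - 2%:P) q0; rewrite szg size_XnsubC // => H.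
  by have := leq_trans H szq; rewrite ltnn.
have Cp : horner_mx Cq ('X^(m.+1) - 2%:P) = 0.
  rewrite rmorphB /= rmorphXn /= horner_mx_X horner_mx_C.
  have -> : Cq ^+ m.+1 = map_mx intr (root2_mx m ^+ m.+1).
    by rewrite -[RHS]/(map_mx _ _) rmorphXn.
  by rewrite root2_mxX map_scalar_mx subrr.
have : horner_mx Cq (a * q + b * ('X^(m.+1) - 2%:P)) \is a GRing.unit.
  apply: rmorph_unit; rewrite poly_unitE.
  have := eqp_size ab1; rewrite size_poly1 => sz1; rewrite sz1 /=.
  have [c c0 ->] := size_poly1P _ (introT eqP sz1).
  by rewrite coefC eqxx unitfE.
rewrite rmorphD !rmorphM /= Cp mulr0 addr0 qE => U.
apply: contraTneq U => D0.
by rewrite -[_ \is a GRing.unit]/(_ \in unitmx) unitmxE det_mulmx det_map_mx D0 mulr0 unitr0.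
Qed.

(** The norm of an algebraic integer is a nonzero integer, so the number itself is
    not small. In matrix form: the number is an eigenvalue of [root2_mul_mx v],
    whose determinant is at least 1 in absolute value and whose entries are of
    size [K]; Cramer's rule applied to the eigenvector of powers of [root2]
    concludes. *)
Lemma root2_liouville (R : realType) (m : nat) :
  exists2 c : R, 0 < c & forall (v : 'rV[int]_m.+1) (K : R), v != 0 ->
    (forall t, `|(v 0 t)%:~R| <= K) ->
    c <= K ^+ m * `|\sum_(t < m.+1) (v 0 t)%:~R * root2 R m ^+ t|.
Proof.
set a := root2 R m.
have a1 : 1 < a := root2_gt1 R m.
pose kap : R := \sum_(t < m.+1) \sum_i \sum_j `|((root2_mx m ^+ t) i j)%:~R|.
have kap0 : 0 <= kap by do 3 (apply: sumr_ge0 => ? _).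
have kapP (t i j : 'I_m.+1) : `|((root2_mx m ^+ t) i j)%:~R| <= kap.
  rewrite /kap (bigD1 t) //= (bigD1 i) //= (bigD1 j) //= -!addrA lerDl.
  rewrite !addr_ge0 //; last by do 3 (apply: sumr_ge0 => ? _).
    by apply: sumr_ge0.
  by do 2 (apply: sumr_ge0 => ? _).
pose L : R := m.+1%:R * (m`!)%N%:R * (m.+1%:R * kap) ^+ m * 2.
have L0 : 0 <= L by rewrite !mulr_ge0 // exprn_ge0 // mulr_ge0.
exists (L + 1)^-1; first by rewrite invr_gt0; lra.
move=> v K v0 vK; set S := \sum_(t < _) _.
have K0 : 0 <= K by apply: le_trans (vK 0).
have D1 : 1 <= `|\det (map_mx intr (root2_mul_mx v)^T : 'M[R]_m.+1)|.
  rewrite det_map_mx det_tr -intr_norm -[1]/(1%:~R) ler_int.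
  by rewrite -gtz0_ge1 normr_gt0 det_root2_mul_mx.
pose w : 'rV[R]_m.+1 := \row_i a ^+ i.
have wC : map_mx intr (root2_mx m) *m w^T = a *: w^T.
  apply/colP => i; rewrite !mxE; under eq_bigr do rewrite !mxE.
  have [im|im] := eqVneq i ord_max.
    rewrite (bigD1 0) //= big1 ?addr0 => [|j j0]; last by rewrite (negbTE j0) mulr0 mul0r.
    by rewrite /= expr0 !mulr1 im -exprS root2X.
  have iS : (i.+1 < m.+1)%N.
    rewrite ltnS ltn_neqAle -ltnS ltn_ord andbT.
    by apply: contraNneq im => im; apply/eqP; apply: val_inj.
  rewrite (bigD1 (Ordinal iS)) //= big1 ?addr0 => [|j j0]; first by rewrite eqxx mul1r exprS.
  case: eqP => [E|_]; last by rewrite mul0r.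
  by case/eqP: j0; exact: val_inj.
have wCX t : map_mx intr (root2_mx m ^+ t) *m w^T = a ^+ t *: w^T.
  elim: t => [|t IH]; first by rewrite expr0 map_mx1 mul1mx scale1r.
  by rewrite exprS map_mxM -mulmxA IH -scalemxAr wC scalerA exprSr.
have wM : w *m map_mx intr (root2_mul_mx v)^T = S *: w.
  apply: trmx_inj; rewrite trmx_mul -map_trmx trmxK linearZ /=.
  rewrite /root2_mul_mx map_mx_sum mulmx_suml scaler_suml; apply: eq_bigr => t _.
  by rewrite map_mxZ -scalemxAl wCX scalerA.
have a2 (j : 'I_m.+1) : a ^+ j <= 2.
  by rewrite -(root2X R m); apply: ler_weXn2l; rewrite ?(ltW a1) // ltnW.
have := @cramer_lower_bound R m.+1 (map_mx intr (root2_mul_mx v)^T) (m.+1%:R * kap * K) (2 *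
  `|S|) w 0.
rewrite !mxE expr0 normr1 mulr1 /= => H.
have {}H : `|\det (map_mx intr (root2_mul_mx v)^T : 'M[R]_m.+1)| <= L * (K ^+ m * `|S|).
  apply: le_trans (H _ _) _ => [i j|j|].
  - rewrite !mxE summxE rmorph_sum /=; apply: le_trans (ler_norm_sum _ _ _) _.
    have -> : m.+1%:R * kap * K = \sum_(t < m.+1) K * kap.
      by rewrite sumr_const card_ord -[RHS]mulr_natl; ring.
    apply: ler_sum => t _; rewrite mxE intrM normrM; apply: ler_pM => //.
  - rewrite wM !mxE normrM mulrC ler_wpM2r // ger0_norm //.
    by rewrite exprn_ge0 // ltW // (lt_trans ltr01).
  - rewrite /L exprMn le_eqVlt; apply/orP; left; apply/eqP => /=; ring.
have y0 : 0 <= K ^+ m * `|S| by rewrite mulr_ge0 // exprn_ge0.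
rewrite -div1r ler_pdivrMr; last by lra.
by rewrite mulrDr mulr1 mulrC; lra.
Qed.

(** * Distance from a rational subspace to generic rows *)

Lemma digits_lt (n p : nat) (f : nat -> nat) : (forall l, (l < p)%N -> (f l < n)%N) ->
  (\sum_(l < p) f l * n ^ l < n ^ p)%N.
Proof.
elim: p => [|p IH] fn; first by rewrite big_ord0.
rewrite big_ord_recr /= expnSr.
have := IH (fun l lp => fn l (ltnW lp)).
have : (n ^ p * (f p).+1 <= n ^ p * n)%N by rewrite leq_mul2l fn ?orbT.
by rewrite mulnS [(n ^ p * f p)%N]mulnC => H1 H2; apply: leq_trans H1; rewrite ltn_add2r.
Qed.

Lemma digits_inj (n p : nat) (f g : nat -> nat) :
  (forall l, (l < p)%N -> (f l < n)%N) -> (forall l, (l < p)%N -> (g l < n)%N) ->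
  (\sum_(l < p) f l * n ^ l = \sum_(l < p) g l * n ^ l)%N ->
  forall l, (l < p)%N -> f l = g l.
Proof.
elim: p => [//|p IH] fn gn; rewrite !big_ord_recr /= => fg.
have fp := digits_lt (fun l lp => fn l (ltnW lp)).
have gp := digits_lt (fun l lp => gn l (ltnW lp)).
have n0 : (0 < n)%N by apply: leq_ltn_trans (fn p (ltnSn p)).
have np : (0 < n ^ p)%N by rewrite expn_gt0 n0.
have efg : f p = g p.
  have := congr1 (fun x => x %/ n ^ p)%N fg.
  by rewrite /= !divnDMl ?mulnK // !(divn_small) // !add0n.
move=> l; rewrite ltnS leq_eqVlt => /orP[/eqP -> //|lp].
apply: IH => //; first by move=> r rp; apply: fn; exact: ltnW.
  by move=> r rp; apply: gn; exact: ltnW.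
by move: fg; rewrite efg => /eqP; rewrite eqn_add2r => /eqP.
Qed.

(** A quantitative form of the fact that the row space of [M] meets [B] only at 0.
    It bounds the coefficients [c] instead of the vector [c *m M], so that it also
    contains the independence of the rows. *)
Definition far (R : realType) (d n : nat) (M : 'M[R]_(d, n)) (B : {vspace 'rV[R]_n}) (delta : R) :=
  forall (c : 'rV[R]_d) (Y : 'rV[R]_n) (eps : R), Y \in B ->
    (forall i, `|(c *m M - Y) 0 i| <= eps) -> forall l, delta * `|c 0 l| <= eps.

(** Steinitz exchange modulo [B]: the quotient by [B], identified with the image
    of [G], has dimension larger than p, so the image of a point outside of [B] can
    be completed by p images of basis vectors. *)
Lemma exists_free_rows (R : realType) (p n : nat) (G : 'M[R]_n) (B : {vspace 'rV[R]_n}) (w :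
  'rV[R]_n) :
  (forall v, (v \in B) = (v *m G == 0)) -> (p.+1 + \dim B <= n)%N -> w \notin B ->
  exists2 s : seq 'I_n, size s = p & free ([seq row i G | i <- s] ++ [:: w *m G]).
Proof.
move=> BG dB wB.
suff H q : (q <= p)%N -> exists2 s : seq 'I_n, size s = q &
    free ([seq row i G | i <- s] ++ [:: w *m G]) by exact: H.
elim: q => [|q IH] qp.
  by exists [::]; rewrite //= seq1_free -BG.
have [s ss sfree] := IH (ltnW qp).
set X := _ ++ _ in sfree.
have [[i Xi]|rX] := pselect (exists i, row i G \notin <<X>>%VS).
  by exists (i :: s); rewrite /= ?ss // free_cons Xi.
have rX' i : row i G \in <<X>>%VS.
  by apply: contraT => H; case: rX; exists i.
have := limg_ker_dim (linfun (mulmxr G : 'rV[R]_n -> 'rV[R]_n)) fullv.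
rewrite capfv => dimE.
have kerE : lker (linfun (mulmxr G : 'rV[R]_n -> 'rV[R]_n)) = B.
  by apply/vspaceP => v; rewrite memv_ker lfunE /= BG.
have : (\dim (rowv G) <= q.+1)%N.
  apply: leq_trans (dimvS (rowv_sub rX')) _.
  by apply: leq_trans (dim_span _) _; rewrite size_cat size_map ss addn1.
move: dimE; rewrite kerE -/(rowv G) dimvf dim_matrix.
rewrite [RHS]mul1r => dimE dimG; exfalso.
have : (n <= \dim B + q.+1)%N by rewrite -[X in (X <= _)%N]dimE leq_add2l.
by move: dB qp; move: (\dim B) => b; lia.
Qed.

Section GenericRows.
Variables (R : realType) (p n : nat).
Hypothesis n0 : (0 < n)%N.

Let m := (n ^ p).-1.
Let mE : m.+1 = (n ^ p)%N.
Proof. by rewrite /m prednK // expn_gt0 n0. Qed.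
Let a := root2 R m.

(** The entries of the first p rows are powers of one number such that choosing
    the column i_l in the row l, for all l < p, produces the exponent with digits
    i_l in base n. Different choices thus give different monomials. *)
Definition gen_mx (P : 'rV[R]_n) : 'M[R]_(p.+1, n) :=
  \matrix_(l, i) if (l < p)%N then a ^+ (i * n ^ l) else P 0 i.

Lemma gen_entry_le (i : 'I_n) l : (l < p)%N -> 0 <= a ^+ (i * n ^ l) <= 2.
Proof.
move=> lp; have a1 : 1 < a := root2_gt1 R m.
rewrite exprn_ge0 ?(ltW (lt_trans ltr01 a1)) //= -(root2X R m) mE.
apply: ler_weXn2l; first exact: ltW.
apply: (@leq_trans (n * n ^ l)); first by rewrite leq_mul2r ltnW ?orbT.
by rewrite -expnS leq_pexp2l.
Qed.

(** Grouped by powers of the root, the expansion of the determinant has the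
    coefficients [v]. As digits determine the columns, the coefficient whose
    exponent has the digits [s l] is the determinant in which each row l < p is
    replaced by the basis vector [s l]. That one of these is nonzero no longer
    involves the root, and [exists_minor] provides it. *)
Lemma det_gen_mx (P : 'rV[int]_n) (Bm : 'M[int]_(n, p.+1)) :
  exists v : 'rV[int]_m.+1,
  [/\ \det (gen_mx (map_mx intr P) *m map_mx intr Bm) = \sum_t (v 0 t)%:~R * a ^+ t,
    forall Q g : R, (forall i, `|(P 0 i)%:~R| <= Q) ->
      (forall i j, `|(Bm i j)%:~R| <= g) ->
      forall t, `|(v 0 t)%:~R| <= (n ^ p.+1)%N%:R * (Q * ((p.+1)`!%N%:R * g ^+ p.+1)) &
    forall s : 'I_p -> 'I_n,
      \det ((\matrix_(l < p.+1, i < n) if insub (l : nat) is Some r then (i == s r)%:R else P 0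
        i) *m Bm) != 0 ->
      v != 0].
Proof.
pose code (f : {ffun 'I_p.+1 -> 'I_n}) := (\sum_(l < p) f (inord l) * n ^ l)%N.
have codeP f : (code f < m.+1)%N by rewrite mE; apply: (@digits_lt n p (fun l => f (inord l))).
pose tm (f : {ffun 'I_p.+1 -> 'I_n}) := P 0 (f ord_max) * \det (rowsub f Bm).
pose v : 'rV[int]_m.+1 := \row_t \sum_(f | Ordinal (codeP f) == t) tm f.
exists v; split.
- rewrite det_mulmx_rowsub.
  rewrite (partition_big (fun f => Ordinal (codeP f)) xpredT) //=; apply: eq_bigr => t _.
  rewrite mxE rmorph_sum /= mulr_suml; apply: eq_bigr => f /eqP ft.
  rewrite /tm intrM -det_map_mx map_mxsub big_ord_recr /= !mxE ltnn.
  rewrite [RHS]mulrC mulrA; congr (_ * _ * _).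
  rewrite -ft /= /code expr_sum; apply: eq_bigr => l _.
  rewrite mxE /= ltn_ord; congr (_ ^+ (nat_of_ord (f _) * _)).
  by apply: val_inj; rewrite /= inordK // ltnS ltnW.
- move=> Q g PQ Bg t; rewrite mxE rmorph_sum /=.
  have Q0 : 0 <= Q by apply: le_trans (PQ (Ordinal n0)).
  have g0 : 0 <= g by apply: le_trans (Bg (Ordinal n0) ord0).
  apply: le_trans (ler_norm_sum _ _ _) _.
  apply: (@le_trans _ _ (\sum_(f : {ffun 'I_p.+1 -> 'I_n}) Q * ((p.+1)`!%N%:R * g ^+ p.+1))).
    rewrite [leRHS](bigID (fun f => Ordinal (codeP f) == t)) /= -[leLHS]addr0.
    apply: lerD; last by apply: sumr_ge0 => f _; rewrite !mulr_ge0 // exprn_ge0.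
    apply: ler_sum => f _; rewrite /tm intrM normrM; apply: ler_pM => //.
    by rewrite -det_map_mx; apply: ler_norm_det => i j; rewrite !mxE; exact: Bg.
  by rewrite sumr_const card_ffun !card_ord -[leLHS]mulr_natl.
- move=> s; apply: contraNneq => v0.
  pose t := (\sum_(l < p) s l * n ^ l)%N.
  pose s' (l : nat) : nat := if insub l is Some r then s r else 0%N.
  have tE : t = (\sum_(l < p) s' l * n ^ l)%N.
    by apply: eq_bigr => l _; rewrite /s' valK.
  have s'n l : (l < p)%N -> (s' l < n)%N by move=> lp; rewrite /s' insubT.
  have tm1 : (t < m.+1)%N by rewrite mE tE; exact: digits_lt.
  apply/eqP; transitivity (v 0 (Ordinal tm1)); last by rewrite v0 mxE.
  rewrite mxE det_mulmx_rowsub [RHS]big_mkcond; apply: eq_bigr => f _ /=.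
  rewrite big_ord_recr /= !mxE insubF ?ltnn //= -/(tm f).
  have [/(congr1 val) /= ft|ft] := eqVneq.
    rewrite big1 ?mul1r // => l _; rewrite !mxE.
    have insl : insub (widen_ord (leqnSn p) l : nat) = Some l by exact: (valK l).
    rewrite insl.
    have : f (inord l) = s' l :> nat.
      apply: (@digits_inj n p (fun l => f (inord l)) s') => //.
      by rewrite -tE.
    rewrite /s' valK => E; rewrite (_ : _ == _) //; apply/eqP/val_inj.
    by rewrite /= -E; congr (nat_of_ord (f _)); apply: val_inj; rewrite /= inordK // ltnS ltnW.
  suff -> : \prod_(i < p) (\matrix_(l, i0) match insub (l : nat) with
     | Some r => (i0 == s r)%:R | None => P 0 i0 end) (widen_ord (leqnSn p) i) (f (widen_ord
       (leqnSn p) i)) = 0.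
    by rewrite !mul0r.
  apply/eqP; apply: contraNT ft => /prodf_neq0 H; apply/eqP/val_inj => /=.
  apply: eq_bigr => l _; congr (_ * _)%N.
  have := H l isT; rewrite !mxE.
  have insl : insub (widen_ord (leqnSn p) l : nat) = Some l by exact: (valK l).
  rewrite insl.
  have -> : widen_ord (leqnSn p) l = inord l by apply: val_inj; rewrite /= inordK // ltnS ltnW.
  by case: (f (inord l) =P s l) => [->//|_]; rewrite eqxx.
Qed.

End GenericRows.

Section GenericFar.
Variables (R : realType) (p n : nat).
Hypothesis n0 : (0 < n)%N.

(** Basis vectors and [P] that are independent modulo [B] exist by
    [exists_free_rows]; a nonzero minor of their images turns this into a
    nonvanishing determinant. *)
Lemma exists_minor (P : 'rV[int]_n) (G : 'M[int]_n) (B : {vspace 'rV[R]_n}) :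
  (forall v, (v \in B) = (v *m map_mx intr G == 0)) -> (p.+1 + \dim B <= n)%N ->
  map_mx intr P \notin B ->
  exists (r : 'I_p -> 'I_n) (s : 'I_p.+1 -> 'I_n),
   \det ((\matrix_(l < p.+1, i < n) if insub (l : nat) is Some r' then (i == r r')%:R else P 0 i)
         *m colsub s G) != 0.
Proof.
move=> BG dB PB; have [t st tfree] := exists_free_rows BG dB PB.
pose r (l : 'I_p) : 'I_n := nth (Ordinal n0) t l; exists r.
set A := \matrix_(l, i) _.
have rowA (l : 'I_p.+1) : row l (map_mx intr (A *m G)) =
    ([seq row i (map_mx intr G) | i <- t] ++ [:: map_mx intr P *m map_mx intr G])`_l.
  rewrite map_mxM row_mul nth_cat size_map st.
  have [lp|lp] := ltnP l p.
    rewrite (nth_map (Ordinal n0)) ?st // [RHS]rowE; congr (_ *m _).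
    apply/rowP => i; rewrite !mxE insubT eqxx /r /=.
    by case: (_ == _).
  have -> : (l - p = 0)%N by apply/eqP; rewrite subn_eq0 -ltnS.
  rewrite /=; congr (_ *m _); apply/rowP => i; rewrite !mxE insubF //.
  by apply/negbTE; rewrite -leqNgt.
have szX : size ([seq row i (map_mx intr G) | i <- t] ++ [:: map_mx intr P *m map_mx intr G :
  'rV[R]_n]) == p.+1.
  by rewrite size_cat size_map st addn1.
have [s D0] : exists s : 'I_p.+1 -> 'I_n, \det (colsub s (A *m G)) != 0.
  apply: (@intr_row_free_minor R) => c; rewrite mulmx_sum_row => c0.
  have /freeP Xfree : free (Tuple szX) by [].
  apply/rowP => i; rewrite mxE; apply: (Xfree (c 0)).
  by rewrite -[RHS]c0; apply: eq_bigr => l _; rewrite rowA.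
by exists s; rewrite mulmx_colsub.
Qed.

(** The key inequality. Applying the integer matrix of [height_kernel] to
    [c *m gen_mx p P - Y] eliminates [Y]. A minor of what remains is a nonzero
    integer combination of powers of the root, so it is bounded below by
    Liouville's inequality, and Cramer's rule recovers [c]. The powers of the
    height and of the size of [P] that are lost depend on n and p only. *)
Lemma gen_mx_far :
  exists2 c : R, 0 < c & exists N : nat, forall (B : {vspace 'rV[R]_n}) (P : 'rV[int]_n) (Q : R),
    is_rational B -> (p.+1 + \dim B <= n)%N -> map_mx intr P \notin B ->
    1 <= Q -> (forall i, `|(P 0 i)%:~R| <= Q) ->
    far (gen_mx p (map_mx intr P)) B (c / (Q * height B) ^+ N).
Proof.
pose m := (n ^ p).-1; pose a := root2 R m.
have [c0 c0_gt0 liouv] := root2_liouville R m.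
pose C1 : R := (n ^ p.+1)%N%:R * ((p.+1)`!%N%:R * 2 ^+ p.+1).
pose C2 : R := p.+1%:R * (p`!)%N%:R * (n%:R * 4) ^+ p * (n%:R * 2).
have C1_ge0 : 0 <= C1 by rewrite !mulr_ge0 // exprn_ge0.
have C2_ge0 : 0 <= C2 by rewrite !mulr_ge0 // exprn_ge0 // mulr_ge0.
have C10 : 0 <= C1 ^+ m * C2 by rewrite mulr_ge0 // exprn_ge0.
exists (c0 / (C1 ^+ m * C2 + 1)); first by rewrite divr_gt0 // ltr_wpDl.
(* One factor z^(p+2) for each of the m powers lost in Liouville's inequality,
   and p + 1 factors from Cramer's rule. *)
exists (p.+2 * m + p.+1)%N => B P Q ratB dB PB Q1 PQ c Y eps YB cY l.
have [G [Gb BG]] := height_kernel ratB.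
have h1 := height_ge1 ratB; set h := height B in Gb h1 *.
set z := Q * h.
have z1 : 1 <= z by rewrite /z -[1]mulr1; apply: ler_pM.
have hz : h <= z by rewrite /z ler_peMl // (le_trans ler01).
have Qz : Q <= z by rewrite /z ler_peMr // (le_trans ler01).
have z0 : 0 <= z by apply: le_trans z1.
have [r [s D0]] := exists_minor BG dB PB.
have [v [vE vb /(_ r D0) v0]] := det_gen_mx R n0 P (colsub s G).
set K := gen_mx _ _ *m _ in vE.
have {}vb t : `|(v 0 t)%:~R : R| <= C1 * z ^+ p.+2.
  apply: le_trans (vb Q (2 * h) PQ _ t) _ => [i j|]; first by rewrite mxE.
  have -> : (n ^ p.+1)%N%:R * (Q * ((p.+1)`!%N%:R * (2 * h) ^+ p.+1)) = C1 * (Q * h ^+ p.+1).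
    by rewrite /C1 exprMn; ring.
  have h0 : 0 <= h by apply: le_trans h1.
  apply: ler_wpM2l => //; rewrite (exprS z).
  have Q0 : 0 <= Q by apply: le_trans Q1.
  have hX : h ^+ p.+1 <= z ^+ p.+1 by rewrite lerXn2r // nnegrE.
  exact: ler_pM Q0 (exprn_ge0 _ h0) Qz hX.
have {liouv} := liouv v _ v0 vb; rewrite -vE => DK.
have wE i : `|(c *m K) 0 i| <= n%:R * 2 * z * eps.
  have -> : (c *m K) 0 i = ((c *m gen_mx p (map_mx intr P) - Y) *m map_mx intr G) 0 (s i).
    have /eqP YG : Y *m map_mx intr G == 0 by rewrite -BG.
    rewrite mulmxBl YG subr0.
    by rewrite /K mulmxA map_mxsub mulmx_colsub mxE.
  rewrite mxE; apply: le_trans (ler_norm_sum _ _ _) _.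
  have -> : n%:R * 2 * z * eps = \sum_(j < n) eps * (2 * z).
    by rewrite sumr_const card_ord -[RHS]mulr_natl; ring.
  apply: ler_sum => j _; rewrite normrM; apply: ler_pM => //; rewrite mxE.
  by apply: le_trans (Gb _ _) _; rewrite ler_wpM2l.
have Kb i j : `|K i j| <= n%:R * 4 * z.
  rewrite mxE; apply: le_trans (ler_norm_sum _ _ _) _.
  have -> : n%:R * 4 * z = \sum_(j < n) (2 * Q) * (2 * h).
    by rewrite sumr_const card_ord -[RHS]mulr_natl /z; ring.
  apply: ler_sum => t _; rewrite normrM; apply: ler_pM => //; last by rewrite !mxE.
  rewrite !mxE; case: ifP => [ip|_].
    have /andP[a0 a2] := gen_entry_le R n0 t ip.
    by rewrite ger0_norm // (le_trans a2) // ler_peMr.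
  by rewrite (le_trans (PQ _)) // ler_peMl // ?ler1n // (le_trans ler01).
have := cramer_lower_bound l Kb wE; rewrite /= => cram.
have eps0 : 0 <= eps by apply: le_trans (cY (Ordinal n0)).
have key : c0 * `|c 0 l| <= (C1 ^+ m * C2) * (z ^+ (p.+2 * m + p.+1) * eps).
  have -> : (C1 ^+ m * C2) * (z ^+ (p.+2 * m + p.+1) * eps) =
     (C1 * z ^+ p.+2) ^+ m * (p.+1%:R * (p`!)%N%:R * (n%:R * 4 * z) ^+ p * (n%:R * 2 * z * eps)).
    rewrite /C2 [(C1 * _) ^+ m]exprMn -exprM [(n%:R * 4 * z) ^+ p]exprMn.
    by rewrite [z ^+ (_ + p.+1)]exprD [z ^+ p.+1]exprS; ring.
  apply: le_trans (ler_wpM2l _ cram); last first.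
    by rewrite exprn_ge0 // mulr_ge0 // exprn_ge0.
  by rewrite mulrA ler_wpM2r.
have zN : 0 < z ^+ (p.+2 * m + p.+1) by rewrite exprn_gt0 // (lt_le_trans ltr01).
rewrite mulrAC ler_pdivrMr // mulrAC ler_pdivrMr ?ltr_wpDl //.
apply: le_trans key _; rewrite mulrC [eps * _]mulrC ler_wpM2l ?lerDl //.
by rewrite mulr_ge0 // ltW.
Qed.

End GenericFar.

(** * The lacunary point and its rational approximations *)

Section LacunaryPoint.
Variables (R : realType) (p k n : nat) (a : nat -> nat).
Hypothesis k0 : (0 < k)%N.
Hypothesis nE : n = (p.+1 + k)%N.
Hypothesis a_lt : forall m, (a m < a m.+1)%N.

Lemma exponent_mono m m' : (m <= m')%N -> (a m <= a m')%N.
Proof. by move=> /subnKC <-; elim: (m' - m)%N => [|r IH];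
  rewrite ?addn0 // addnS (leq_trans IH) // ltnW. Qed.

Definition lac_psum (c j : nat) : R := \sum_(m < j.+1 | (m %% k == c)%N) 2 ^- a m.

Definition lac_sum (c : nat) : R := limn (lac_psum c).

Lemma exp2V_gt0 m : 0 < 2 ^- m :> R.
Proof. by rewrite invr_gt0 exprn_gt0. Qed.

Lemma lac_psumS c j : lac_psum c j.+1 = lac_psum c j + (if (j.+1 %% k == c)%N then 2 ^- a j.+1
  else 0).
Proof. by rewrite /lac_psum big_mkcond big_ord_recr /= -big_mkcond. Qed.

Lemma lac_psum_homo c : {homo lac_psum c : m m' / (m <= m')%N >-> m <= m'}.
Proof.
apply: homo_leq => [//|x y z|m]; first exact: le_trans.
rewrite lac_psumS lerDl; case: ifP => _ //; exact: ltW (exp2V_gt0 _).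
Qed.

(** The exponents increase strictly, so each term of the series is at most half of
    the preceding one. *)
Lemma exp2V_half m : 2 * 2 ^- a m.+1 <= 2 ^- a m :> R.
Proof.
rewrite ler_pdivrMr ?exprn_gt0 // mulrC ler_pdivlMr ?exprn_gt0 // -exprS.
by apply: ler_weXn2l; [rewrite ler1n|exact: a_lt].
Qed.

(** The subtracted term, a bound for what follows, is what makes the induction
    work. *)
Lemma lac_psum_tail c j r : lac_psum c (j + r) <= lac_psum c j + 2 * 2 ^- a j.+1 - 2 * 2 ^- a
  (j + r).+1.
Proof.
elim: r => [|r IH]; first by rewrite addn0 addrK.
rewrite addnS lac_psumS; have := exp2V_half (j + r).+1; have := exp2V_gt0 (a (j + r).+1).
by case: ifP => _; lra.
Qed.

Lemma lac_psum_le c j r : lac_psum c (j + r) <= lac_psum c j + 2 * 2 ^- a j.+1.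
Proof. by have := lac_psum_tail c j r; have := exp2V_gt0 (a (j + r).+1); lra. Qed.

Lemma lac_psum_cvg c : cvgn (lac_psum c).
Proof.
apply: nondecreasing_is_cvgn; first exact: lac_psum_homo.
exists (lac_psum c 0 + 2 * 2 ^- a 1) => _ [m _ <-].
exact: (lac_psum_le c 0 m).
Qed.

Lemma lac_psum_le_sum c j : lac_psum c j <= lac_sum c.
Proof. by apply: nondecreasing_cvgn_le; [exact: lac_psum_homo|exact: lac_psum_cvg]. Qed.

Lemma lac_sum_le_psum c j : lac_sum c <= lac_psum c j + 2 * 2 ^- a j.+1.
Proof.
apply: limr_le; first exact: lac_psum_cvg.
exists j => // m /= jm; rewrite -(subnKC jm); exact: lac_psum_le.
Qed.

Lemma lac_psum_ge0 c j : 0 <= lac_psum c j.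
Proof. by apply: sumr_ge0 => m _; exact: ltW (exp2V_gt0 _). Qed.

Lemma lac_sum_le2 c : 0 <= lac_sum c <= 2.
Proof.
rewrite (le_trans (lac_psum_ge0 c 0) (lac_psum_le_sum c 0)) /=.
apply: le_trans (lac_sum_le_psum c 0) _.
have H : lac_psum c 0 <= 2 ^- a 0.
  rewrite /lac_psum big_mkcond big_ord_recl big_ord0 /= addr0; case: ifP => _; first exact: lexx.
  exact: ltW (exp2V_gt0 _).
have := exp2V_half 0; have : 2 ^- a 0 <= 1 :> R by rewrite invf_le1 ?exprn_gt0 // exprn_ege1 //
  ler1n.
by lra.
Qed.

Lemma lac_psum_le2 c j : lac_psum c j <= 2.
Proof. by have /andP[_] := lac_sum_le2 c; apply: le_trans; exact: lac_psum_le_sum. Qed.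

(** The index of the coordinate to which the m-th term of the series belongs. *)
Definition dir (m : nat) : nat := (p.+1 + m %% k)%N.

Lemma dir_lt m : (dir m < n)%N.
Proof. by rewrite nE ltn_add2l ltn_pmod. Qed.

Lemma dir_neq j r r' : (r < r')%N -> (r' < r + k)%N -> dir (j + r) != dir (j + r').
Proof.
move=> rr' r'k; rewrite eqn_add2l; apply/negP => /eqP E.
have : (j + r) = (j + r') %[mod k] by [].
move/esym/eqP; rewrite eqn_mod_dvd ?leq_add2l ?(ltnW rr') // subnDl => /dvdn_leq.
by rewrite subn_gt0 rr' => /(_ isT); rewrite leqNgt ltn_subLR ?(ltnW rr') // r'k.
Qed.

(** The first p coordinates are left to the rows that are powers of the root, and
    the coordinate p carries the denominator. *)
Definition affine_point (z : nat -> R) : 'rV[R]_n :=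
  \row_(i < n) if (i < p)%N then 0 else if i == p :> nat then 1 else z (i - p.+1)%N.

Definition lac_point : 'rV[R]_n := affine_point lac_sum.

Definition partial_point (j : nat) : 'rV[R]_n := affine_point (lac_psum ^~ j).

Definition int_point (j : nat) : 'rV[int]_n :=
  \row_(i < n) if (i < p)%N then 0 else if i == p :> nat then (2 ^ a j)%N%:Z
    else (\sum_(m < j.+1 | m %% k == i - p.+1) 2 ^ (a j - a m))%N%:Z.

Lemma int_pointE j : map_mx intr (int_point j) = 2 ^+ a j *: partial_point j.
Proof.
apply/rowP => i; rewrite !mxE; case: ifP => _; first by rewrite mulr0.
case: ifP => _; first by rewrite mulr1 -pmulrn natrX.
rewrite -pmulrn natr_sum mulr_sumr; apply: eq_bigr => m _.
rewrite natrX expfB_cond ?pnatr_eq0 //=.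
by rewrite exponent_mono // -ltnS.
Qed.

Lemma lac_point_approx j i : `|(lac_point - partial_point j) 0 i| <= 2 * 2 ^- a j.+1.
Proof.
have e0 := exp2V_gt0 (a j.+1).
rewrite !mxE; case: ifP => _; first by rewrite subrr normr0; lra.
case: ifP => _; first by rewrite subrr normr0; lra.
rewrite ger0_norm ?subr_ge0 ?lac_psum_le_sum // lerBlDl; exact: lac_sum_le_psum.
Qed.

Lemma int_point_le j i : `|(int_point j 0 i)%:~R : R| <= 2 * 2 ^+ a j.
Proof.
have -> : (int_point j 0 i)%:~R = 2 ^+ a j * partial_point j 0 i.
  by have /rowP/(_ i) := int_pointE j; rewrite mxE => ->; rewrite mxE.
rewrite normrM ger0_norm ?exprn_ge0 // mulrC ler_wpM2r ?exprn_ge0 //.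
rewrite mxE; case: ifP => _; first by rewrite normr0.
case: ifP => _; first by rewrite normr1 ler1n.
by rewrite ger0_norm ?lac_psum_ge0 // lac_psum_le2.
Qed.

Definition dir_vec (m : nat) : 'rV[int]_n := \row_(i < n) (i == dir m :> nat)%:R.

(** Consecutive approximations differ by a basis vector, up to scaling: the span
    of several of them has the height of the first one only. *)
Lemma int_pointS j : int_point j.+1 = (2 ^ (a j.+1 - a j))%N%:Z *: int_point j + dir_vec j.+1.
Proof.
apply/rowP => i; rewrite !mxE /dir; case: ifP => ip.
  by rewrite mulr0 add0r ltn_eqF // (leq_trans ip) // (leq_trans _ (leq_addr _ _)) // leqnSn.
case: ifP => [/eqP ->|inp].
  rewrite ltn_eqF ?leq_addr // addr0 -PoszM -expnD subnK //; exact: ltnW.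
have pi : (p < i)%N by rewrite ltn_neqAle eq_sym inp leqNgt ip.
rewrite big_mkcond big_ord_recr /= -big_mkcond /= PoszD subnn expn0; congr (_ + _).
  rewrite -PoszM; congr Posz; rewrite big_distrr /=; apply: eq_bigr => m _.
  by rewrite -expnD addnBA ?exponent_mono -1?ltnS // subnK // ltnW.
have -> : (i == (p.+1 + j.+1 %% k)%N :> nat) = (j.+1 %% k == i - p.+1)%N.
  by rewrite -[in LHS](subnKC pi) eqn_add2l eq_sym.
by case: ifP.
Qed.

(** A basis of the span of [int_point j], ..., [int_point (j + e - 1)] in which
    only the first row is large. *)
Definition frame_mx (e j : nat) : 'M[int]_(e, n) :=
  \matrix_(r < e) if r == 0 :> nat then int_point j else dir_vec (j + r).

Lemma frame_mx_mem (B : {vspace 'rV[R]_n}) e j :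
  (forall i, (j <= i < j + e)%N -> map_mx intr (int_point i) \in B) ->
  forall r, map_mx intr (row r (frame_mx e j)) \in B.
Proof.
move=> PB r; rewrite rowK; case: eqP => [r0|/eqP r0].
  by apply: PB; rewrite leqnn /= -[X in (X < _)%N]addn0 ltn_add2l (leq_ltn_trans _ (ltn_ord r)).
have := ltn_ord r; move: r0; case: (nat_of_ord r) => [//|q] _ qe.
have -> : dir_vec (j + q.+1) = int_point (j + q).+1 - (2 ^ (a (j + q).+1 - a (j + q)))%N%:Z *:
  int_point (j + q).
  by rewrite int_pointS addrC addrA addNr add0r addnS.
rewrite map_mxB map_mxZ rpredB // ?rpredZ // PB //.
  by rewrite -addnS leq_addr ltn_add2l.
by rewrite leq_addr ltn_add2l ltnW.
Qed.

Lemma frame_mx_inj e j (c : 'rV[R]_e) : (e <= k.+1)%N ->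
  c *m map_mx intr (frame_mx e j) = 0 -> c = 0.
Proof.
move=> ek cU; case: e => [|e] in ek c cU *; first by apply/rowP => -[].
have pn : (p < n)%N by rewrite nE addSn ltnS leq_addr.
have c0 : c 0 ord0 = 0.
  have /rowP/(_ (Ordinal pn)) := cU; rewrite !mxE (bigD1 ord0) //= big1 ?addr0 => [|r r0].
    rewrite !mxE /= ltnn eqxx => /eqP; rewrite mulf_eq0 intr_eq0 => /orP[/eqP //|].
    by rewrite eqz_nat expn_eq0.
  by rewrite !mxE (negbTE (_ : val r != 0%N)) // !mxE /dir ltn_eqF ?mulr0 // leq_addr.
apply/rowP => r; rewrite mxE.
have [->//|r0] := eqVneq r ord0.
have /rowP/(_ (Ordinal (dir_lt (j + r)))) := cU.
rewrite !mxE (bigD1 ord0) //= c0 mul0r add0r (bigD1 r) //= big1 ?addr0.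
  by rewrite !mxE (negbTE (_ : val r != 0%N)) // !mxE eqxx mulr1.
move=> s /andP[s0 sr]; rewrite !mxE (negbTE (_ : val s != 0%N)) // !mxE /=.
suff /negbTE -> : dir (j + r) != dir (j + s) by rewrite mulr0.
have rl := ltn_ord r; have sl := ltn_ord s.
have r1 : (0 < r)%N by rewrite lt0n.
have s1 : (0 < s)%N by rewrite lt0n.
have : val r != val s by rewrite eq_sym.
rewrite neq_ltn => /orP[rs|rs]; last rewrite eq_sym; apply: dir_neq => //; lia.
Qed.

(** On these columns the rows below the first one form part of the identity
    matrix, so the minor is triangular. *)
Lemma frame_mx_minor e j (q : 'I_n) : (0 < e)%N ->
  (forall r, (0 < r < e)%N -> q != dir (j + r) :> nat) -> (e <= k)%N ->
  \det (colsub (fun r : 'I_e => if r == 0 :> nat then q else Ordinal (dir_lt (j + r)))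
    (frame_mx e j))
  = int_point j 0 q.
Proof.
case: e => // e _ qdir ek; rewrite -det_tr det_trig; last first.
  apply/is_trig_mxP => r s rs; rewrite !mxE.
  have s0 : (0 < s)%N by apply: leq_ltn_trans rs.
  rewrite (negbTE (_ : val s != 0%N)) -?lt0n // mxE.
  rewrite -[(r == 0 :> nat)%N]/(val r == 0%N).
  have [_|r0] := eqVneq (val r) 0%N.
    by rewrite (negbTE (qdir s _)) // s0 ltn_ord.
  suff /negbTE -> : dir (j + r) != dir (j + s) by [].
  by apply: dir_neq => //; have := ltn_ord s; lia.
rewrite big_ord_recl big1 ?mulr1 => [|r _]; first by rewrite !mxE.
by rewrite !mxE /= eqxx.
Qed.

End LacunaryPoint.

(** * Height of the subspaces spanned by consecutive approximations *)

Section FrameHeight.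
Variables (R : realType) (p k n : nat) (a : nat -> nat).
Hypothesis k0 : (0 < k)%N.
Hypothesis nE : n = (p.+1 + k)%N.
Hypothesis a_lt : forall m, (a m < a m.+1)%N.
Local Notation ppt := (@int_point p k n a).
Local Notation umat := (@frame_mx p k n a).
Local Notation den j := (2 ^+ a j : R).
Implicit Types B : {vspace 'rV[R]_n}.

Lemma int_point_den j (i : 'I_n) : (i = p :> nat) -> ppt j 0 i = (2 ^ a j)%N%:Z.
Proof. by move=> ip; rewrite mxE ip ltnn eqxx. Qed.

(** All terms of the partial sum but the last are even. *)
Lemma int_point_odd j (i : 'I_n) : (i = dir p k j :> nat) -> ~~ (2 %| ppt j 0%R i)%Z.
Proof.
move=> ij; rewrite mxE ij /dir ltnNge (leq_trans (leqnSn p)) ?leq_addr //=.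
rewrite gtn_eqF ?leq_addr //= addKn dvdzE /= big_mkcond big_ord_recr /= eqxx subnn expn0.
rewrite -big_mkcond dvdn_addr // big_mkcond; apply: dvdn_sum => m _.
case: ifP => _ //; have H : (a m < a j)%N.
  by apply: leq_trans (a_lt m) _; apply: (exponent_mono a_lt).
by rewrite -[(a j - a m)%N]prednK ?subn_gt0 // expnS dvdn_mulr.
Qed.

Lemma frame_mx_le1 e j (r : 'I_e) i : val r != 0%N -> `|(umat e j r i)%:~R : R| <= 1.
Proof.
move=> r0; rewrite !mxE (negbTE (_ : val r != 0%N)) // mxE.
by case: (_ == _); rewrite ?normr1 ?normr0.
Qed.

(** The minors of [frame_mx] that use the columns p and [dir j] for the first row
    are 2^a_j and an odd number. A change of basis from a Z-basis to the rows of
    [frame_mx] has a determinant dividing both, hence equal to 1 or -1, so these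
    rows form a Z-basis and the height is the norm of their wedge product. *)
Lemma height_frame_mx B j : is_rational B -> (0 < \dim B <= k)%N ->
  B = rowv (map_mx intr (umat (\dim B) j)) ->
  den j <= height B <= (n ^ \dim B)%N%:R * ((\dim B)%:R * ((\dim B)`!)%N%:R * 2 * den j).
Proof.
move=> ratB /andP[e0 ek] BU.
have BUv v : (v \in B) = (v \in rowv (map_mx intr (umat (\dim B) j))) by rewrite -BU.
have [M [-> BM Minj /(_ _ (umat (\dim B) j))]] := height_Zbasis ratB.
case=> [i|T UT].
  by rewrite map_row BUv; exact: row_in_rowv.
have pn : (p < n)%N by rewrite nE addSn ltnS leq_addr.
have U1 := @frame_mx_minor p k n a k0 nE (\dim B) j (Ordinal pn) e0.
have U2 := @frame_mx_minor p k n a k0 nE (\dim B) j (Ordinal (dir_lt k0 nE j)) e0.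
rewrite UT -!mulmx_colsub !det_mulmx in U1 U2.
have {}U1 := U1 _ ek; have {}U2 := U2 _ ek.
set D1 := \det (colsub _ M) in U1; set D2 := \det (colsub _ M) in U2.
have {}U1 : \det T * D1 = (2 ^ a j)%N%:Z.
  rewrite U1 => [|r /= _]; first exact: int_point_den.
  by rewrite ltn_eqF // /dir leq_addr.
have U2odd : ~~ (2 %| \det T * D2)%Z.
  rewrite U2 => [|r /= /andP[r1 re]]; first exact: int_point_odd.
  by rewrite -[in dir p k j](addn0 j); apply: dir_neq => //; rewrite add0n (leq_trans re).
have T1 : `|\det T|%N = 1%N.
  have : (`|\det T| %| 2 ^ a j)%N.
    by have := congr1 absz U1; rewrite abszM /= => <-; exact: dvdn_mulr.
  move=> /dvdn_pfactor -/(_ isT)[[|b] _ //].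
  rewrite expnS => E; case/negP: U2odd.
  by rewrite dvdzE abszM E /= -mulnA dvdn_mulr.
have T1R : `|\det (map_mx intr T : 'M[R]_(\dim B))| = 1.
  by rewrite det_map_mx -intr_norm -abszE T1.
have wE : wedge_norm (map_mx intr M : 'M[R]_(\dim B, n)) =
    wedge_norm (map_mx intr (umat (\dim B) j) : 'M[R]_(\dim B, n)).
  by rewrite UT map_mxM wedge_norm_mul T1R mul1r.
apply/andP; split.
  have -> : den j = `|(D1)%:~R : R|.
    have := congr1 (fun z : int => `|z%:~R : R|) U1.
    by rewrite /= intrM normrM -[(\det T)%:~R]det_map_mx T1R mul1r => ->;
      rewrite -pmulrn natrX ger0_norm ?exprn_ge0.
  by rewrite /D1 -det_map_mx map_mxsub minor_le_wedge_norm.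
rewrite wE; apply: wedge_norm_le => [|s]; first by rewrite !mulr_ge0 // exprn_ge0.
rewrite (expand_det_row _ (Ordinal e0)); apply: le_trans (ler_norm_sum _ _ _) _.
have -> : (\dim B)%:R * ((\dim B)`!)%N%:R * 2 * den j =
    \sum_(i < \dim B) (2 * den j) * ((\dim B)`!)%N%:R.
  by rewrite sumr_const card_ord -[RHS]mulr_natl; ring.
apply: ler_sum => i _; rewrite normrM; apply: ler_pM => //.
  rewrite (_ : colsub s _ _ _ = (ppt j 0 (s i))%:~R); last by rewrite !mxE.
  exact: int_point_le.
rewrite /cofactor normrM normrX normrN1 expr1n mul1r.
apply: le_trans (@ler_norm_det _ _ _ 1 _) _ => [r t|].
  rewrite (_ : row' _ _ r t = (umat (\dim B) j (lift (Ordinal e0) r) (s (lift i t)))%:~R);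
    last by rewrite !mxE.
  exact: frame_mx_le1.
rewrite expr1n mulr1 ler_nat.
by case: (\dim B) e0 => // e' _; rewrite factS leq_pmull.
Qed.

End FrameHeight.

(** * Distance to the subspaces spanned by consecutive approximations *)

Section FrameDistance.
Variables (R : realType) (p k n : nat) (a : nat -> nat).
Hypothesis k0 : (0 < k)%N.
Hypothesis nE : n = (p.+1 + k)%N.
Hypothesis a_lt : forall m, (a m < a m.+1)%N.
Local Notation ppt := (@int_point p k n a).
Local Notation umat := (@frame_mx p k n a).
Local Notation den j := (2 ^+ a j : R).
Local Notation x := (@lac_point R p k n a).
Implicit Types B : {vspace 'rV[R]_n}.

Let n0 : (0 < n)%N. Proof. by rewrite nE. Qed.
Let pn : (p < n)%N. Proof. by rewrite nE addSn ltnS leq_addr. Qed.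

Lemma gen_mxE (P : 'rV[R]_n) (c : 'rV[R]_p.+1) i :
  (c *m gen_mx p P) 0 i =
  \sum_(l < p) c 0 (widen_ord (leqnSn p) l) * root2 R (n ^ p).-1 ^+ (i * n ^ l) +
  c 0 ord_max * P 0 i.
Proof.
rewrite mxE big_ord_recr /= [gen_mx p P ord_max i]mxE ltnn; congr (_ + _).
by apply: eq_bigr => l _; rewrite mxE /= ltn_ord.
Qed.

(** After division of the last row by the denominator, the two matrices differ by
    at most 2 / 2^a_(j+1). *)
Lemma far_perturb B (j : nat) (delta : R) : 0 <= delta ->
  far (gen_mx p (map_mx intr (ppt j))) B delta -> 4 * den j <= delta * den j.+1 ->
  far (gen_mx p x) B (delta / (2 * den j)).
Proof.
move=> d0 Pfar dj c Y eps YB cY.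
have X1 : 1 <= den j by rewrite exprn_ege1 // ler1n.
have X0 : 0 < den j by apply: lt_le_trans X1.
have X'0 : 0 < den j.+1 by rewrite exprn_gt0.
set cm := c 0 ord_max.
pose c' : 'rV[R]_p.+1 := \row_l (if l == ord_max then c 0 l / den j else c 0 l).
have c'Y i : `|(c' *m gen_mx p (map_mx intr (ppt j)) - Y) 0 i| <= eps + `|cm| * (2 / den j.+1).
  have -> : (c' *m gen_mx p (map_mx intr (ppt j)) - Y) 0 i =
     (c *m gen_mx p x - Y) 0 i - cm * (x - @partial_point R p k n a j) 0 i.
    rewrite (int_pointE R p k n a_lt) mxE gen_mxE [in RHS]mxE gen_mxE.
    under eq_bigr => l _.
      rewrite mxE ifF; last by apply/negbTE; rewrite -val_eqE /= neq_ltn ltn_ord.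
      over.
    have E1 : (den j *: @partial_point R p k n a j) 0 i = den j * @partial_point R p k n a j 0
      i by rewrite mxE.
    have E2 : (x - @partial_point R p k n a j) 0 i = x 0 i - @partial_point R p k n a j 0 i by
      rewrite !mxE.
    have E3 : c' 0 ord_max = cm / den j by rewrite mxE eqxx.
    rewrite E1 E2 E3 -/cm /=.
    by field; rewrite gt_eqF.
  apply: le_trans (ler_normB _ _) _; apply: lerD; first exact: cY.
  by rewrite normrM ler_wpM2l //; exact: lac_point_approx.
have key l := Pfar c' Y _ YB c'Y l.
have kmax := key ord_max; rewrite mxE eqxx -/cm normrM normfV (ger0_norm (ltW X0)) in kmax.
have cm0 : 0 <= `|cm| by [].
have h1 : `|cm| * (2 / den j.+1) <= delta * (`|cm| / den j) / 2.
  have -> : delta * (`|cm| / den j) / 2 = `|cm| * (delta / (2 * den j)).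
    by field; rewrite gt_eqF.
  rewrite ler_wpM2l // ler_pdivrMr // mulrAC ler_pdivlMr ?mulr_gt0 //.
  by rewrite mulrA -natrM.
have h2 : delta * `|c' 0 ord_max| <= 2 * eps.
  by rewrite mxE eqxx -/cm normrM normfV (ger0_norm (ltW X0)); lra.
have h3 : `|cm| * (2 / den j.+1) <= eps by lra.
move=> l.
rewrite mulrAC ler_pdivrMr ?mulr_gt0 //.
have := key l; rewrite mxE; case: eqP => [->|_].
  rewrite -/cm normrM normfV (ger0_norm (ltW X0)) => _.
  rewrite (_ : eps * (2 * den j) = (2 * eps) * den j); last by ring.
  by rewrite -ler_pdivrMr // -mulrA; lra.
move=> H; apply: (@le_trans _ _ (2 * eps)); first by lra.
rewrite (_ : eps * (2 * den j) = (2 * eps) * den j); last by ring.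
rewrite ler_peMr // mulr_ge0 //.
by apply: le_trans (cY (Ordinal n0)).
Qed.

(** On the first p columns, the rows of powers form a Vandermonde matrix with
    distinct nodes a^(n^l). *)
Lemma vandermonde_bound : exists2 C : R, 0 <= C & forall (c : 'rV[R]_p) eps,
  (forall i : 'I_p, `|\sum_(l < p) c 0 l * root2 R (n ^ p).-1 ^+ (i * n ^ l)| <= eps) ->
  forall l, `|c 0 l| <= C * eps.
Proof.
set al := root2 R _.
have al1 : 1 < al := root2_gt1 R _.
pose V : 'M[R]_p := \matrix_(l, i) al ^+ (i * n ^ l).
have VE : V = (Vandermonde p (\row_l al ^+ (n ^ l)))^T.
  by apply/matrixP => l i; rewrite !mxE -exprM mulnC.
have D0 : \det V != 0.
  rewrite VE det_tr det_Vandermonde; apply/prodf_neq0 => i _.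
  apply/prodf_neq0 => l il; rewrite !mxE subr_eq0 gt_eqF //.
  by rewrite ltr_eXn2l // ltn_exp2l // nE addSn ltnS addn_gt0 k0 orbT.
exists (p%:R * (p.-1)`!%N%:R * 2 ^+ p.-1 / `|\det V|).
  by rewrite divr_ge0 // !mulr_ge0 // exprn_ge0.
move=> c eps ceps l.
rewrite mulrAC ler_pdivlMr ?normr_gt0 // mulrC.
apply: cramer_lower_bound => [r i|i]; rewrite mxE.
  have ip : (i < n)%N by rewrite (leq_trans (ltn_ord i)) // ltnW.
  have /andP[g0 g2] := gen_entry_le R n0 (Ordinal ip) (ltn_ord r).
  by rewrite ger0_norm.
by under eq_bigr do rewrite mxE; exact: ceps.
Qed.

(** The first p coordinates vanish on the subspace and on the lacunary point, so
    they control the coefficients of the rows of powers. The remaining coefficient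
    is controlled by the linear form X_(dir (j + e)) - S X_p, where S is the
    partial sum up to j: it vanishes on the subspace, and takes a value of at
    least 2^-a_(j+e) at the lacunary point. *)
Lemma far_frame_mx : exists2 C : R, 0 < C & forall e j, (0 < e <= k)%N ->
  far (gen_mx p x) (rowv (map_mx intr (umat e j) : 'M[R]_(e, n))) (C / den (j + e)).
Proof.
have [C1 C1_ge0 vand] := vandermonde_bound.
set al := root2 R _ in vand.
pose C := (3 + 6 * p%:R * C1 + C1)^-1.
have den0 : 0 < 3 + 6 * p%:R * C1 + C1.
  by rewrite -addrA ltr_pwDl // addr_ge0 // !mulr_ge0.
exists C; first by rewrite invr_gt0.
move=> e j /andP[e0 ek] c Y eps /rowvP[b YE] cY.
have eps0 : 0 <= eps by apply: le_trans (cY (Ordinal n0)).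
have YU i : Y 0 i = \sum_r b 0 r * (umat e j r i)%:~R.
  by rewrite YE mxE; apply: eq_bigr => r _; rewrite [map_mx _ _ _ _]mxE.
have Ysmall (i : 'I_n) : (i < p)%N -> Y 0 i = 0.
  move=> ip; rewrite YU big1 // => r _; rewrite !mxE.
  case: eqP => _; first by rewrite mxE ip mulr0.
  rewrite mxE ltn_eqF ?mulr0 //.
  by rewrite /dir (leq_trans ip) // (leq_trans _ (leq_addr _ _)).
have xsmall (i : 'I_n) : (i < p)%N -> x 0 i = 0 by move=> ip; rewrite mxE ip.
have cl (l : 'I_p) : `|c 0 (widen_ord (leqnSn p) l)| <= C1 * eps.
  have := vand (\row_l c 0 (widen_ord (leqnSn p) l)) eps _ l; rewrite mxE; apply => i.
  have ip : (i < n)%N by rewrite (leq_trans (ltn_ord i)) // ltnW.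
  have := cY (Ordinal ip); rewrite mxE gen_mxE [(- Y) _ _]mxE Ysmall //= xsmall //= mulr0 subr0
    addr0.
  by under [in X in _ -> X]eq_bigr do rewrite mxE.
pose i1 : 'I_n := Ordinal (dir_lt k0 nE (j + e)).
pose ip : 'I_n := Ordinal pn.
pose S := lac_psum R k a ((j + e) %% k)%N j.
have S2 : 0 <= S <= 2 by rewrite lac_psum_ge0 lac_psum_le2.
have Yl : Y 0 i1 = S * Y 0 ip.
  have sum1 (i : 'I_n) : (forall r : 'I_e, val r != 0%N -> i != dir p k (j + r) :> nat) ->
      Y 0 i = b 0 (Ordinal e0) * (ppt j 0 i)%:~R.
    move=> H; rewrite YU (bigD1 (Ordinal e0)) //= big1 ?addr0 => [|r r0].
      by rewrite !mxE.
    have r0' : val r != 0%N by [].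
    by rewrite mxE (negbTE r0') mxE (negbTE (H r r0')) mulr0.
  rewrite (sum1 i1) ?(sum1 ip).
  - have pq i : (ppt j 0 i)%:~R = den j * @partial_point R p k n a j 0 i.
      by have /rowP/(_ i) := int_pointE R p k n a_lt j; rewrite mxE => ->; rewrite mxE.
    rewrite !pq [@partial_point _ _ _ _ _ _ _ i1]mxE [@partial_point _ _ _ _ _ _ _ ip]mxE /=
      ltnn eqxx.
    rewrite /dir ltnNge (leq_trans (leqnSn p)) ?leq_addr //= gtn_eqF ?leq_addr // addKn -/S.
    by ring.
  - by move=> r _; rewrite /= /dir ltn_eqF // leq_addr.
  - move=> r r0 /=; rewrite eq_sym.
    by apply: dir_neq; have := ltn_ord r; move: r0; rewrite -lt0n /=; lia.
have xl : 2 ^- a (j + e) <= x 0 i1 - S.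
  have -> : x 0 i1 = lac_sum R k a ((j + e) %% k)%N.
    by rewrite mxE /= /dir ltnNge (leq_trans (leqnSn p)) ?leq_addr //= gtn_eqF ?leq_addr // addKn.
  have := lac_psum_le_sum R k a_lt ((j + e) %% k)%N (j + e)%N.
  rewrite -(prednK e0) addnS lac_psumS eqxx.
  have := lac_psum_homo R k a ((j + (e.-1).+1) %% k)%N (leq_addr e.-1 j).
  by rewrite /S -(prednK e0) addnS /=; lra.
have cis := cY i1; have cip := cY ip.
have xp : x 0 ip = 1 by rewrite mxE /= ltnn eqxx.
rewrite mxE gen_mxE [(- Y) _ _]mxE Yl in cis.
rewrite mxE gen_mxE [(- Y) _ _]mxE xp mulr1 in cip.
set T1 := \sum_(l < p) _ in cis; set T2 := \sum_(l < p) _ in cip.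
have Tb (i : 'I_n) : `|\sum_(l < p) c 0 (widen_ord (leqnSn p) l) * al ^+ (i * n ^ l)| <= p%:R *
  (2 * C1 * eps).
  apply: le_trans (ler_norm_sum _ _ _) _.
  have -> : p%:R * (2 * C1 * eps) = \sum_(l < p) (C1 * eps) * 2.
    by rewrite sumr_const card_ord -[RHS]mulr_natl; ring.
  apply: ler_sum => l _; rewrite normrM; apply: ler_pM => //.
  by have /andP[g0 g2] := gen_entry_le R n0 i (ltn_ord l); rewrite ger0_norm.
have T1b : `|T1| <= _ := Tb i1; have T2b : `|T2| <= _ := Tb ip.
set cm := c 0 ord_max in cis cip.
have cmb : `|cm| * 2 ^- a (j + e) <= (3 + 6 * p%:R * C1) * eps.
  apply: (@le_trans _ _ `|cm * (x 0 i1 - S)|).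
    rewrite normrM ler_wpM2l //; apply: le_trans xl _; exact: ler_norm.
  have -> : cm * (x 0 i1 - S) = (T1 + cm * x 0 i1 - S * Y 0 ip) - S * (T2 + cm - Y 0 ip) - T1 +
    S * T2.
    by ring.
  have Sb z b' : `|z| <= b' -> `|S * z| <= 2 * b'.
    move=> zb; rewrite normrM; apply: ler_pM => //.
    by case/andP: S2 => S0 S2; rewrite ger0_norm.
  have SY := Sb _ _ cip; have ST := Sb _ _ T2b.
  apply: le_trans (ler_normD _ _) _.
  apply: le_trans (lerD (ler_normB _ _) (lexx _)) _.
  apply: le_trans (lerD (lerD (ler_normB _ _) (lexx _)) (lexx _)) _.
  by rewrite -!/cm in cis cip *; lra.
have e2 : 0 < 2 ^- a (j + e) :> R := exp2V_gt0 R _.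
have e21 : 2 ^- a (j + e) <= 1 :> R by rewrite invf_le1 ?exprn_gt0 // exprn_ege1 // ler1n.
have pC1 : 0 <= p%:R * C1 by rewrite mulr_ge0.
move=> l; rewrite /C -mulrA mulrC ler_pdivrMr //.
have [lp|lp] := ltnP l p.
  have -> : l = widen_ord (leqnSn p) (Ordinal lp) by exact: val_inj.
  apply: (@le_trans _ _ (1 * (C1 * eps))).
    exact: ler_pM (ltW e2) (normr_ge0 _) e21 (cl _).
  have : 0 <= p%:R * C1 * eps by rewrite mulr_ge0.
  by lra.
have -> : l = ord_max by apply: val_inj; apply/eqP; rewrite eqn_leq /= lp -ltnS ltn_ord.
have : 0 <= C1 * eps by rewrite mulr_ge0.
by rewrite -/cm (mulrC (2 ^- a (j + e))); lra.
Qed.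

End FrameDistance.

(** * Distance to all rational subspaces *)

Lemma far_le (R : realType) (d n : nat) (M : 'M[R]_(d, n)) B (t u : R) :
  far M B u -> t <= u -> far M B t.
Proof.
move=> Mfar tu c Y eps YB cY l; apply: le_trans (Mfar c Y eps YB cY l).
by rewrite ler_wpM2r.
Qed.

Section RationalDistance.
Variables (R : realType) (p k n : nat) (a : nat -> nat).
Hypothesis k0 : (0 < k)%N.
Hypothesis nE : n = (p.+1 + k)%N.
Hypothesis a_lt : forall m, (a m < a m.+1)%N.
Local Notation ppt := (@int_point p k n a).
Local Notation umat := (@frame_mx p k n a).
Local Notation den j := (2 ^+ a j : R).
Local Notation x := (@lac_point R p k n a).
Implicit Types B : {vspace 'rV[R]_n}.

Variables (c0 : R) (N0 : nat).
Hypothesis c0_gt0 : 0 < c0.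
Hypothesis gen_far : forall B (P : 'rV[int]_n) (Q : R),
    is_rational B -> (p.+1 + \dim B <= n)%N -> map_mx intr P \notin B ->
    1 <= Q -> (forall i, `|(P 0 i)%:~R| <= Q) ->
    far (gen_mx p (map_mx intr P)) B (c0 / (Q * height B) ^+ N0).

Let N := N0.+1.
Let D := 4 * 2 ^+ N0 / c0.

Lemma den_ge1 j : 1 <= den j.
Proof. by rewrite exprn_ege1 // ler1n. Qed.

Lemma den_gt0 j : 0 < den j.
Proof. exact: lt_le_trans (den_ge1 j). Qed.

Lemma den_mono i j : (i <= j)%N -> den i <= den j.
Proof. by move=> ij; apply: ler_weXn2l; [rewrite ler1n | exact: exponent_mono]. Qed.

(** The bound of [gen_mx_far] for the approximation [int_point j] survives the
    passage to the lacunary point as soon as the next denominator is much larger. *)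
Lemma far_step B j : is_rational B -> (\dim B <= k)%N -> map_mx intr (ppt j) \notin B ->
  D * (den j * height B) ^+ N <= den j.+1 ->
  far (gen_mx p x) B (c0 / 2 ^+ N / (den j * height B) ^+ N).
Proof.
move=> ratB dB PB Dj.
have h1 := height_ge1 ratB; set h := height B in h1 Dj *.
have X1 := den_ge1 j; have X0 := den_gt0 j.
have h0 : 0 < h by apply: lt_le_trans h1.
have Xh : 0 < (den j * h) ^+ N0 by rewrite exprn_gt0 // mulr_gt0.
have dBn : (p.+1 + \dim B <= n)%N by rewrite [X in (_ <= X)%N]nE leq_add2l.
have Q1 : 1 <= 2 * den j by move: X1; lra.
have := gen_far ratB dBn PB Q1 (int_point_le R p k a_lt j); rewrite -/h.
set delta := c0 / _ => Pfar.
have deltaE : delta = c0 / 2 ^+ N0 / (den j * h) ^+ N0.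
  by rewrite /delta -mulrA exprMn invfM mulrA.
have d0 : 0 < delta by rewrite deltaE !divr_gt0 // exprn_gt0.
have step : 4 * den j <= delta * den j.+1.
  apply: le_trans (ler_wpM2l (ltW d0) Dj).
  have -> : delta * (D * (den j * h) ^+ N) = 4 * (den j * h).
    rewrite deltaE /D /N exprS; field.
    by rewrite !gt_eqF //= exprn_gt0.
  by rewrite ler_wpM2l // ler_peMr // ltW.
have PF := far_perturb nE a_lt (ltW d0) Pfar step.
apply: far_le PF _.
have -> : delta / (2 * den j) = c0 / 2 ^+ N / (den j * h) ^+ N * h.
  by rewrite deltaE /N !exprS; field; rewrite !gt_eqF //= exprn_gt0.
rewrite ler_peMr // !divr_ge0 ?exprn_ge0 ?ltW // mulr_gt0 //.
Qed.

Hypothesis grow : forall j, D ^+ 2 * den j ^+ (2 * N) <= den j.+1.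
Variables (g : nat -> R) (C3 : R).
Hypothesis g0 : forall r, 0 <= g r.
Hypothesis gN : forall e, (0 < e <= k)%N -> N%:R * (2 * N%:R * g e.-1 + 1) <= g e.
Hypothesis C3_gt0 : 0 < C3.
Hypothesis den_g : forall m r, (r <= k)%N -> den (m + r) <= C3 * den m `^ g r.

(** k + 1 consecutive approximations are linearly independent. *)
Lemma exists_notin B j : (\dim B <= k)%N -> exists i, (j <= i)%N && (map_mx intr (ppt i) \notin B).
Proof.
move=> dB; apply: contrapT => none.
have PB i : (j <= i)%N -> map_mx intr (ppt i) \in B.
  by move=> ji; apply: contraT => PB; case: none; exists i; rewrite ji.
have UB : (rowv (map_mx intr (umat k.+1 j)) <= B)%VS.
  apply: rowv_sub => i; rewrite -map_row.
  by apply: (@frame_mx_mem R p k n a a_lt) => i' /andP[ji' _]; exact: PB.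
have dU : \dim (rowv (map_mx intr (umat k.+1 j) : 'M[R]_(k.+1, n))) = k.+1.
  by apply: dim_rowv => c; exact: (frame_mx_inj k0 nE).
by have := leq_trans (dimvS UB) dB; rewrite dU ltnn.
Qed.

Lemma eq_frame_mx B e j : \dim B = e -> (e <= k.+1)%N ->
  (forall i, (j <= i < j + e)%N -> map_mx intr (ppt i) \in B) ->
  B = rowv (map_mx intr (umat e j)).
Proof.
move=> dB ek PB; apply/esym/eqP.
have dU : \dim (rowv (map_mx intr (umat e j) : 'M[R]_(e, n))) = e.
  by apply: dim_rowv => c; exact: (frame_mx_inj k0 nE).
rewrite eqEdim dU dB leqnn andbT.
by apply: rowv_sub => r; rewrite -map_row; apply: (@frame_mx_mem R p k n a a_lt).
Qed.

(** With j the first index such that 2^a_(j+1) is at least h^(2N), [far_step] applies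
    from j on. If one of the approximations j, ..., j + e - 1 is outside of [B], [far_step]
      gives a distance whose
    exponent is controlled by [g e.-1], and [gN] absorbs the losses. Otherwise [B]
    is spanned by these approximations and [far_frame_mx] gives the exponent
    [g e]. *)
Lemma far_rational e : (0 < e <= k)%N -> exists2 C : R, 0 < C &
  forall B, rational_subspaces R n e B -> far (gen_mx p x) B (C / height B `^ g e).
Proof.
move=> /andP[e0 ek].
have [Cu Cu0 ufar] := far_frame_mx R k0 nE a_lt.
(* The factor [den 0] accounts for the case j = 0, where 2^a_j is not bounded by
   a power of h through minimality. *)
pose K1 := (C3 * den 0 `^ g e.-1) ^+ N.
have K10 : 0 < K1 by rewrite exprn_gt0 // mulr_gt0 // powR_gt0 // den_gt0.
pose C := Num.min (c0 / 2 ^+ N / K1) (Cu / C3).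
have C0 : 0 < C by rewrite /C lt_min !divr_gt0 // exprn_gt0.
exists C => // B [dB ratB].
have h1 := height_ge1 ratB; set h := height B in h1 *.
have h0 : 0 < h by apply: lt_le_trans h1.
have hg0 : 0 < h `^ g e by rewrite powR_gt0.
have exj : exists j, h ^+ (2 * N) <= den j.+1.
  exists (Num.bound (h ^+ (2 * N))).
  apply: (@le_trans _ _ (2 ^+ Num.bound (h ^+ (2 * N)))).
    by apply: ltW; apply: upper_nthrootP.
  apply: ler_weXn2l; first by rewrite ler1n.
  suff H m : (m <= a m)%N by apply: leq_trans (H _).
  by elim: m => [//|m IH]; apply: leq_ltn_trans IH (a_lt m).
pose j := ex_minn exj.
have [hj Xj] : h ^+ (2 * N) <= den j.+1 /\ den j <= den 0 * h ^+ (2 * N).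
  rewrite /j; case: ex_minnP => j' hj' jmin; split=> //.
  case: j' hj' jmin => [|j'] hj' jmin.
    by rewrite ler_peMr ?exprn_ege1 // ltW // den_gt0.
  apply: (@le_trans _ _ (h ^+ (2 * N))).
    by rewrite ltW // ltNge; apply/negP => /jmin; rewrite ltnn.
  by rewrite ler_peMl ?den_ge1 // exprn_ge0 // ltW.
have growh i : (j <= i)%N -> D * (den i * h) ^+ N <= den i.+1.
  move=> ji; have X0 := den_gt0 i.
  have D0 : 0 <= D by rewrite /D divr_ge0 ?(ltW c0_gt0) // mulr_ge0 // exprn_ge0.
  have y0 : 0 <= (den i * h) ^+ N by rewrite exprn_ge0 // mulr_ge0 // ltW.
  have Dy0 : 0 <= D * (den i * h) ^+ N by rewrite mulr_ge0.
  (* After squaring, one factor 2^a_(i+1) absorbs the power of 2^a_i by [grow],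
     and the other the power of h by the choice of j. *)
  rewrite -(@ler_pXn2r _ 2) ?nnegrE ?(ltW (den_gt0 _)) // exprMn -exprM [(N * 2)%N]mulnC [(den
    i * h) ^+ _]exprMn mulrA.
  rewrite [leRHS]expr2; apply: ler_pM (grow i) _.
  - by rewrite mulr_ge0 ?exprn_ge0 // ltW.
  - by rewrite exprn_ge0 // ltW.
  - by apply: le_trans hj _; apply: den_mono.
have dBk : (\dim B <= k)%N by rewrite dB.
pose i := ex_minn (exists_notin j dBk).
have [ji PiB Pi] : [/\ (j <= i)%N, map_mx intr (ppt i) \notin B &
    forall r, (j <= r < i)%N -> map_mx intr (ppt r) \in B].
  rewrite /i; case: ex_minnP => i' /andP[ji' Pi'] imin; split=> // r /andP[jr ri].
  by apply: contraT => Pr; have := imin r; rewrite jr Pr leqNgt ri => /(_ isT).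
have [iej|jei] := ltnP i (j + e).
  apply: far_le (far_step ratB dBk PiB (growh i ji)) _.
  rewrite -/h.
  have Xi : den i <= (C3 * den 0 `^ g e.-1) * (h ^+ (2 * N)) `^ g e.-1.
    rewrite -mulrA -powRM ?exprn_ge0 // ?(ltW h0) //.
    apply: (@le_trans _ _ (den (j + e.-1))).
      by apply: den_mono; rewrite -ltnS -addnS prednK.
    apply: le_trans (den_g _ _) _; first by rewrite (leq_trans (leq_pred _)).
    rewrite ler_wpM2l ?(ltW C3_gt0) // ge0_ler_powR ?nnegrE ?(ltW (den_gt0 _)) //.
    by rewrite mulr_ge0 ?exprn_ge0 // ltW.
  have Xih : (den i * h) ^+ N <= K1 * h `^ g e.
    apply: (@le_trans _ _ (K1 * h `^ (N%:R * (2 * N%:R * g e.-1 + 1)))); last first.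
      rewrite ler_wpM2l ?(ltW K10) //; apply: ler_powR => //.
      by apply: gN; rewrite e0 ek.
    have -> : h `^ (N%:R * (2 * N%:R * g e.-1 + 1)) = ((h ^+ (2 * N)) `^ g e.-1 * h) ^+ N.
      have -> : (h ^+ (2 * N)) `^ g e.-1 = h `^ (2 * N%:R * g e.-1).
        by rewrite -(powR_mulrn (2 * N) (ltW h0)) -powRrM natrM.
      have -> : h `^ (2 * N%:R * g e.-1) * h = h `^ (2 * N%:R * g e.-1 + 1).
        rewrite powRD; first by rewrite (powRr1 (ltW h0)).
        by rewrite (gt_eqF h0) implybT.
      by rewrite -powR_mulrn ?powR_ge0 // -powRrM mulrC.
    rewrite /K1 -exprMn; apply: lerXn2r.
    - by rewrite nnegrE mulr_ge0 ?(ltW h0) // ltW // den_gt0.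
    - by rewrite nnegrE !mulr_ge0 ?powR_ge0 ?(ltW h0) // ltW.
    - by rewrite mulrA ler_wpM2r // ltW.
  have XiN0 : 0 < (den i * h) ^+ N by rewrite exprn_gt0 // mulr_gt0 // den_gt0.
  apply: (@le_trans _ _ (c0 / 2 ^+ N / K1 / h `^ g e)).
    by rewrite ler_wpM2r ?invr_ge0 ?powR_ge0 // /C ge_min lexx.
  rewrite -mulrA -invfM ler_wpM2l ?divr_ge0 ?exprn_ge0 ?(ltW c0_gt0) //.
  by rewrite lef_pV2 ?posrE // mulr_gt0.
have BU : B = rowv (map_mx intr (umat e j)).
  apply: eq_frame_mx => //; first exact: leqW.
  by move=> r /andP[jr re]; apply: Pi; rewrite jr (leq_trans re).
have Xh : den j <= h.
  have dimB : (0 < \dim B <= k)%N by rewrite dB e0 ek.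
  have BU' : B = rowv (map_mx intr (umat (\dim B) j)) by rewrite dB.
  by have /andP[] := height_frame_mx k0 nE a_lt ratB dimB BU'.
have BUfar : far (gen_mx p x) B (Cu / den (j + e)) by rewrite BU; apply: ufar; rewrite e0 ek.
apply: far_le BUfar _.
apply: (@le_trans _ _ (Cu / C3 / h `^ g e)).
  by rewrite ler_wpM2r ?invr_ge0 ?powR_ge0 // /C ge_min lexx orbT.
rewrite -mulrA -invfM ler_wpM2l ?(ltW Cu0) // lef_pV2 ?posrE ?den_gt0 ?mulr_gt0 //.
apply: le_trans (den_g _ ek) _; rewrite ler_wpM2l ?(ltW C3_gt0) //.
by rewrite ge0_ler_powR ?nnegrE ?(ltW (den_gt0 _)) // ltW.
Qed.

End RationalDistance.

(** * From distances to exponents *)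

Lemma far_inj (R : realType) (d n : nat) (M : 'M[R]_(d, n)) (B : {vspace 'rV[R]_n}) (t : R) :
  0 < t -> far M B t -> forall c : 'rV[R]_d, c *m M \in B -> c = 0.
Proof.
move=> t0 Mfar c cB; apply/rowP => l; rewrite mxE; apply/eqP.
rewrite -normr_le0 -(pmulr_rle0 _ t0); apply: (Mfar c (c *m M) 0 cB) => i.
by rewrite subrr mxE normr0.
Qed.

Lemma far_capv (R : realType) (d n : nat) (M : 'M[R]_(d, n)) (B : {vspace 'rV[R]_n}) (t : R) :
  0 < t -> far M B t -> (rowv M :&: B = 0)%VS.
Proof.
move=> t0 Mfar; apply/eqP; rewrite -subv0; apply/subvP => v.
rewrite memv_cap memv0 => /andP[/rowvP[c ->]] /(far_inj t0 Mfar) ->.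
by rewrite mul0mx.
Qed.

(** If [c *m M] makes an angle with sine w with a vector of [B], its distance to [B]
    is at most a constant times w times the largest coefficient of [c]; being far
    bounds it from below by [t] times that same coefficient. *)
Lemma psi_ge_far (R : realType) (d n : nat) (M : 'M[R]_(d, n)) (B : {vspace 'rV[R]_n}) (b t : R) :
  (forall c : 'rV[R]_d, c *m M = 0 -> c = 0) -> (0 < d)%N -> (0 < \dim B)%N -> (d + \dim B <=
    n)%N ->
  0 < b -> (forall i j, `|M i j| <= b) -> far M B t ->
  t <= n%:R * n%:R * d%:R * b * psi 1 (rowv M) B.
Proof.
move=> Minj d0 dB dBn b0 Mb Mfar.
have dM := dim_rowv Minj.
have dM0 : (0 < \dim (rowv M))%N by rewrite dM.
have dMn : (\dim (rowv M) + \dim B <= n)%N by rewrite dM.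
have [[X [Y [/rowvP[c XE] X0 YB Y0 ->]]] _] := psi1P dM0 dB dMn.
have [l lP] := omega_approx X0 Y0.
have c0 : c != 0 by apply: contraNneq X0 => c0; rewrite XE c0 mul0mx.
have [i iM] := exists_max_coord c0.
have ci : 0 < `|c 0 i|.
  rewrite lt_def normr_ge0 andbT; apply: contraNneq c0 => ci.
  by apply/eqP/rowP => r; rewrite mxE; apply/eqP; rewrite -normr_le0 -ci.
have w0 : 0 <= omega X Y by rewrite divr_ge0 ?sqrtr_ge0 // mulr_ge0 ?enorm_ge0.
have eX : enorm X <= n%:R * (d%:R * (`|c 0 i| * b)).
  apply: enorm_le => [|j]; first by rewrite !mulr_ge0 // ltW.
  rewrite XE mxE; apply: le_trans (ler_norm_sum _ _ _) _.
  rewrite -[X in X%:R](card_ord d) mulr_natl -sumr_const; apply: ler_sum => r _.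
  by rewrite normrM ler_pM.
have := Mfar c (l *: Y) (n%:R * omega X Y * enorm X) (rpredZ _ YB) _ i.
have H j : `|(c *m M - l *: Y) 0 j| <= n%:R * omega X Y * enorm X.
  by have := lP j; rewrite XE !mxE.
move=> /(_ H) {}H; rewrite -(ler_pM2r ci); apply: le_trans H _.
apply: (@le_trans _ _ (n%:R * omega X Y * (n%:R * (d%:R * (`|c 0 i| * b))))).
  by rewrite ler_wpM2l // mulr_ge0.
by rewrite le_eqVlt; apply/orP; left; apply/eqP; ring.
Qed.

Lemma finite_set_lower (R : realType) (T : choiceType) (S : set T) (f : T -> R) :
  finite_set S -> (forall s, S s -> 0 < f s) -> exists2 c, 0 < c & forall s, S s -> c <= f s.
Proof.
move=> /finite_seqP[s ->] f0.
elim: s f0 => [|u s IH] f0; first by exists 1 => // v; rewrite /= in_nil.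
have [|c c0 cs] := IH; first by move=> v vs; apply: f0; rewrite /= inE vs orbT.
exists (Num.min c (f u)); first by rewrite lt_min c0 f0 //= inE eqxx.
move=> v /=; rewrite inE => /orP[/eqP ->|vs]; first by rewrite ge_min lexx orbT.
by rewrite ge_min cs.
Qed.

Section Exponent.
Variables (R : realType) (n : nat) (A : {vspace 'rV[R]_n}) (e : nat) (g : R).
Hypothesis g0 : 0 < g.

(** Above [g], the lower bound for psi forces the height to be bounded, which leaves
    finitely many subspaces. Below [g], the subspaces [Bs i] satisfy the inequality
    and cannot be finite in number, since psi is positive on each of them and tends
    to 0 along the sequence. *)
Lemma mu_exp_eq (cl : R) (Bs : nat -> {vspace 'rV[R]_n}) (cu cw : R) (r : nat -> R) :
  0 < cl -> (forall B, rational_subspaces R n e B -> cl / height B `^ g <= psi 1 A B) ->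
  0 < cu -> 0 < cw -> (forall M : R, exists i, [/\ M <= r i, 1 <= r i, rational_subspaces R n e
    (Bs i),
    height (Bs i) <= cu * r i & psi 1 A (Bs i) <= cw / r i `^ g]) ->
  mu_exp e 1 A = g%:E.
Proof.
move=> cl0 low cu0 cw0 up; apply/eqP; rewrite eq_le; apply/andP; split.
  apply: ge_ereal_sup => _ [->|[m [m0 minf] <-]]; first by rewrite lee_fin ltW.
  rewrite lee_fin leNgt; apply/negP => gm; apply: minf.
  apply: sub_finite_set (height_finite n (cl^-1 `^ (m - g)^-1)) => B [[dB ratB] Bpsi].
  split=> //.
  have h1 := height_ge1 ratB; have h0 : 0 < height B by apply: lt_le_trans h1.
  have mg : 0 < m - g by rewrite subr_gt0.
  have : height B `^ (m - g) <= cl^-1.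
    have := le_trans (low B (conj dB ratB)) Bpsi.
    have hg : 0 < height B `^ g by rewrite powR_gt0.
    have -> : height B `^ (- m) = (height B `^ (m - g) * height B `^ g)^-1.
      by rewrite -powRD ?(gt_eqF h0) ?implybT // subrK powRN.
    rewrite invfM ler_pM2r ?invr_gt0 // => H.
    by rewrite -[leLHS]invrK lef_pV2 ?posrE ?invr_gt0 ?powR_gt0.
  move=> /(@ge0_ler_powR _ (m - g)^-1) H.
  have {}H := H _ _ _; rewrite -powRrM divff ?gt_eqF // powRr1 in H; last exact: ltW.
  by apply: H; rewrite ?nnegrE ?invr_ge0 ?powR_ge0 // ltW.
have sup_ge (m : R) : 0 < m -> m < g -> (m%:E <= mu_exp e 1 A)%E.
  move=> m0 mg; apply: ereal_sup_ubound; right; exists m => //; split=> //.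
  move=> Sfin.
  have := @finite_set_lower R _ _ (fun B => psi 1 A B) Sfin; case=> [B [rB _]|c c0 cS].
    apply: lt_le_trans (low B rB).
    by rewrite divr_gt0 // powR_gt0 // (lt_le_trans ltr01) // height_ge1 //; case: rB.
  have gm : 0 < g - m by rewrite subr_gt0.
  (* From this size on, the first bound turns cw / r^g into at most (cu r)^-m, and the second
     makes cw / r^g smaller than c. *)
  pose M := Num.max ((cw * cu `^ m) `^ (g - m)^-1) (((cw / c) + 1) `^ g^-1).
  have [i [Mr r1 rB hB pB]] := up M.
  have r0 : 0 < r i by apply: lt_le_trans r1.
  have h1 := height_ge1 rB.2; have h0 : 0 < height (Bs i) by apply: lt_le_trans h1.
  have le1 : cw * cu `^ m <= r i `^ (g - m).
    have : (cw * cu `^ m) `^ (g - m)^-1 <= r i by apply: le_trans Mr; rewrite le_max lexx.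
    move=> /(@ge0_ler_powR _ (g - m) (ltW gm));
      rewrite -powRrM mulVf ?gt_eqF // powRr1 ?mulr_ge0 ?powR_ge0 ?(ltW cw0) //.
    by apply; rewrite nnegrE ?powR_ge0 // ltW.
  have le2 : cw / c + 1 <= r i `^ g.
    have : (cw / c + 1) `^ g^-1 <= r i by apply: le_trans Mr; rewrite le_max lexx orbT.
    have cw1 : 0 <= cw / c + 1 by rewrite addr_ge0 // divr_ge0 // ltW.
    move=> /(@ge0_ler_powR _ g (ltW g0)); rewrite -powRrM mulVf ?gt_eqF // powRr1 //.
    by apply; rewrite nnegrE ?powR_ge0 // ltW.
  have rg0 : 0 < r i `^ g by rewrite powR_gt0.
  have : c <= psi 1 A (Bs i).
    apply: cS; split=> //; apply: le_trans pB _; rewrite powRN.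
    rewrite ler_pdivrMr // -ler_pdivrMl ?invr_gt0 ?powR_gt0 // invrK.
    apply: (@le_trans _ _ ((cu * r i) `^ m * cw)).
      rewrite ler_wpM2r ?(ltW cw0) // ge0_ler_powR ?nnegrE ?(ltW m0) ?(ltW h0) //.
      by rewrite mulr_ge0 // ltW.
    rewrite powRM ?(ltW cu0) ?(ltW r0) // mulrAC [_ * cw]mulrC.
    have -> : r i `^ g = r i `^ (g - m) * r i `^ m.
      by rewrite -powRD ?(gt_eqF r0) ?implybT // subrK.
    by rewrite ler_wpM2r ?powR_ge0.
  apply/negP; rewrite -ltNge; apply: le_lt_trans pB _.
  rewrite ltr_pdivrMr // mulrC -ltr_pdivrMr //.
  by apply: lt_le_trans le2; rewrite ltrDl.
have g2 : 0 < g / 2 by rewrite divr_gt0.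
apply/lee_addgt0Pr => eps eps0.
have [geps|geps] := ltP eps g.
  have := sup_ge (g - eps); rewrite subr_gt0 geps gtrBl eps0 => /(_ isT isT).
  by rewrite -leeBlDr // -EFinB.
apply: (@le_trans _ _ eps%:E); first by rewrite lee_fin.
by rewrite leeDr //; apply: ereal_sup_ubound; left.
Qed.

End Exponent.

(** * Subspaces with prescribed exponents *)

Section Windows.
Variables (R : realType) (k : nat) (t : nat -> R).
Hypothesis t_gt0 : forall i, 0 < t i.
Hypothesis t_per : forall i, t (i + k)%N = t i.
Hypothesis t_anti : forall i j, (i <= j < k)%N -> t j <= t i.

Definition window (m r : nat) : R := \prod_(i < r) t (m + i).

Lemma window_gt0 m r : 0 < window m r.
Proof. by apply: prodr_gt0. Qed.

Lemma window_shift m r : window m.+1 r * t m = window m r * t (m + r).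
Proof.
have E1 : window m r.+1 = window m r * t (m + r) by rewrite /window big_ord_recr.
rewrite -E1 /window big_ord_recl addn0 mulrC; congr (_ * _).
by apply: eq_bigr => i _; rewrite addSnnS.
Qed.

Lemma window_per m q r : window (m + q * k) r = window m r.
Proof.
apply: eq_bigr => i _; elim: q => [|q IH]; first by rewrite addn0.
by rewrite mulSn [(k + _)%N]addnC addnA addnAC t_per.
Qed.

(** Up to the start k - r, the factors of the window are dominated one by one by
    those of the first window. Beyond it, sliding the window to the right replaces
    a factor by a larger one from the beginning of the next period, until the next
    period is reached. *)
Lemma window_le m r : (r <= k)%N -> window m r <= window 0 r.
Proof.
move=> rk; have [k0|k0] := posnP k.
  by move: rk; rewrite k0 leqn0 => /eqP ->; rewrite /window !big_ord0.
rewrite (divn_eq m k) addnC window_per.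
have mk : (m %% k < k)%N by rewrite ltn_pmod.
move: (m %% k)%N mk => {}m mk.
have [mr|mr] := leqP (m + r) k.
  apply: ler_prod => i _; rewrite ltW //= add0n; apply: t_anti.
  by rewrite leq_addl (leq_trans _ mr) // ltn_add2l.
suff H q : (q <= r)%N -> window (k - q) r <= window 0 r.
  have := H (k - m)%N; rewrite subKn ?(ltnW mk) //; apply.
  by rewrite leq_subLR ltnW.
elim: q => [_|q IH qr].
  by rewrite subn0 -[k]add0n -[X in (_ + X)%N]mul1n window_per.
apply: le_trans _ (IH (ltnW qr)).
have qk : (q < k)%N by apply: leq_trans rk.
have := window_shift (k - q.+1) r; rewrite subnSK // => E.
rewrite -(ler_pM2r (t_gt0 (k - q.+1 + r)%N)) -E.
rewrite ler_wpM2l ?(ltW (window_gt0 _ _)) //.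
have -> : (k - q.+1 + r = (r - q.+1) + k)%N by lia.
by rewrite t_per; apply: t_anti; lia.
Qed.

End Windows.

Lemma partial_point_mem (R : realType) (p k n : nat) (a : nat -> nat)
   (a_lt : forall m, (a m < a m.+1)%N) e m q : (q < e)%N ->
  @partial_point R p k n a (m + q) \in rowv (map_mx intr (@frame_mx p k n a e m) : 'M[R]_(e, n)).
Proof.
set V := rowv _ => qe.
have rV r (re : (r < e)%N) : map_mx intr (row (Ordinal re) (@frame_mx p k n a e m)) \in V.
  by rewrite map_row; exact: row_in_rowv.
have PV : map_mx intr (@int_point p k n a (m + q)) \in V.
  elim: q qe => [|q IH] qe; first by have := rV 0%N qe; rewrite rowK /= addn0.
  rewrite addnS (@int_pointS p k n a a_lt) map_mxD map_mxZ rpredD ?rpredZ ?IH // ?(ltnW qe) //.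
  by have := rV q.+1 qe; rewrite rowK /= addnS.
have -> : @partial_point R p k n a (m + q) = (2 ^+ a (m + q))^-1 *: map_mx intr (@int_point p k
  n a (m + q)).
  by rewrite (int_pointE R p k n a_lt) scalerA mulVf ?scale1r // expf_neq0 // pnatr_eq0.
exact: rpredZ.
Qed.

(** The exponents a_m are the integer parts of tau_m, where
    tau_(m+r) = tau_m (t_m ... t_(m+r-1)). By [window_le] the ratio
    tau_(m+e) / tau_m is at most t_0 ... t_(e-1), with equality when m is a
    multiple of k. *)
Lemma exists_subspace (R : realType) (p k n : nat) : (0 < k)%N -> n = (p.+1 + k)%N ->
  exists2 S : R, 0 < S & forall t : nat -> R, (forall i, S <= t i) ->
    (forall i, t (i + k)%N = t i) -> (forall i j, (i <= j < k)%N -> t j <= t i) ->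
    exists A : {vspace 'rV[R]_n}, forall e, (0 < e <= k)%N ->
      irrational_subspaces R n p.+1 e 1 A /\ mu_exp e 1 A = (\prod_(i < e) t i)%:E.
Proof.
move=> k0 nE; have n0 : (0 < n)%N by rewrite nE.
have [c0 c0_gt0 [N0 gen_far]] := gen_mx_far R p n0.
pose N := N0.+1; pose D := 4 * 2 ^+ N0 / c0.
(* This value of S makes t_(e-1) absorb the losses N (2 N g + 1) <= N (2 N + 1) g
   in [far_rational]. *)
exists (N%:R * (2 * N%:R + 1)); first by rewrite mulr_gt0 // ltr_wpDl.
move=> t tS t_per t_anti.
have N1 : 1 <= N%:R :> R by rewrite ler1n.
have S1 : 2 * N%:R + 1 <= N%:R * (2 * N%:R + 1) :> R by rewrite ler_peMl // addr_ge0.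
have t3 i : 3 <= t i by apply: le_trans (tS i); lra.
have t_gt0 i : 0 < t i by have := t3 i; lra.
pose c' := Num.bound (D ^+ 2).
have Dc : D ^+ 2 <= 2 ^+ c' by apply: ltW; apply: upper_nthrootP.
(* The initial value is large enough for the growth condition on the integer parts
   to include the constant factor D^2 <= 2^c'. *)
pose tau m : R := c'.+1%:R * window t 0 m.
have tauS m : tau m.+1 = tau m * t m by rewrite /tau /window big_ord_recr /= add0n mulrA.
have tau_ge m : c'.+1%:R <= tau m.
  elim: m => [|m IH]; first by rewrite /tau /window big_ord0 mulr1.
  rewrite tauS; apply: le_trans IH _; rewrite ler_peMr //; last by have := t3 m; lra.
  by rewrite mulr_ge0 // ltW // window_gt0.
have tau0 m : 0 <= tau m by apply: le_trans (tau_ge m).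
have tauD m r : tau (m + r)%N = tau m * window t m r.
  rewrite /tau -mulrA; congr (_ * _); elim: r => [|r IH].
    by rewrite addn0 /window big_ord0 mulr1.
  by rewrite addnS /window !big_ord_recr /= -!/(window _ _ _) IH mulrA add0n.
pose a m := Num.truncn (tau m).
have a_le m : (a m)%:R <= tau m by rewrite -truncn_ge_nat.
have a_gt m : tau m < (a m).+1%:R by rewrite -truncn_lt_nat.
have a_step m : (c' + 2 * N * a m <= a m.+1)%N.
  rewrite truncn_ge_nat // natrD natrM tauS.
  have h1 := tau_ge m; have h2 := a_le m; have h3 := le_trans S1 (tS m).
  have h4 : tau m * (2 * N%:R + 1) <= tau m * t m by rewrite ler_wpM2l.
  have h5 : 2 * N%:R * (a m)%:R <= 2 * N%:R * tau m by rewrite ler_wpM2l // mulr_ge0.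
  by rewrite natrM -[c'.+1]addn1 natrD in h1 *; lra.
have a_lt m : (a m < a m.+1)%N.
  rewrite truncn_ge_nat // tauS -natr1.
  have h1 := tau_ge m; have h2 := a_le m; have h3 := t3 m.
  have h4 : tau m * 3 <= tau m * t m by rewrite ler_wpM2l.
  have h5 : 1 <= c'.+1%:R :> R by rewrite ler1n.
  by lra.
have grow j : D ^+ 2 * (2 ^+ a j) ^+ (2 * N) <= 2 ^+ a j.+1 :> R.
  apply: (@le_trans _ _ (2 ^+ (c' + 2 * N * a j)%N)).
    rewrite exprD -exprM mulnC ler_wpM2r // exprn_ge0 //.
  by apply: ler_weXn2l => //; rewrite ler1n.
pose g r := window t 0 r.
have g_ge0 r : 0 <= g r by rewrite ltW // window_gt0.
have gS r : g r.+1 = g r * t r by rewrite /g /window big_ord_recr.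
have g_ge1 r : 1 <= g r.
  elim: r => [|r IH]; first by rewrite /g /window big_ord0.
  by rewrite gS -[1]mulr1; apply: ler_pM => //; have := t3 r; lra.
have g_mono r s : (r <= s)%N -> g r <= g s.
  move=> rs; rewrite -(subnKC rs); elim: (s - r)%N => [|q IH]; first by rewrite addn0.
  by rewrite addnS gS; apply: le_trans IH _; rewrite ler_peMr //; have := t3 (r + q)%N; lra.
have gN e : (0 < e <= k)%N -> N%:R * (2 * N%:R * g e.-1 + 1) <= g e.
  case: e => // e _ /=; rewrite gS; apply: (@le_trans _ _ (g e * (N%:R * (2 * N%:R + 1)))).
    have := ler_wpM2l (ler0n R N) (g_ge1 e); rewrite mulr1 => H.
    by lra.
  by rewrite ler_wpM2l.
pose C3 : R := 2 `^ g k.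
have C3_gt0 : 0 < C3 by rewrite powR_gt0.
have pw m : 2 ^+ m = 2 `^ m%:R :> R by rewrite powR_mulrn.
have den_g m r : (r <= k)%N -> 2 ^+ a (m + r)%N <= C3 * (2 ^+ a m) `^ g r.
  move=> rk; rewrite !pw -powRrM /C3 -powRD ?pnatr_eq0 ?implybT //.
  apply: ler_powR; first by rewrite ler1n.
  apply: le_trans (a_le _) _; rewrite tauD.
  apply: (@le_trans _ _ (tau m * g r)).
    by rewrite ler_wpM2l // (window_le t_gt0 t_per t_anti).
  apply: (@le_trans _ _ ((a m).+1%:R * g r)); first by rewrite ler_wpM2r // ltW.
  by rewrite -natr1 mulrDl mul1r addrC lerD2r g_mono.
pose x := @lac_point R p k n a.
pose A := rowv (gen_mx p x).
exists A => e /andP[e0 ek].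
have ge : g e = \prod_(i < e) t i by apply: eq_bigr => i _; rewrite add0n.
have ek1 : (0 < e <= k)%N by rewrite e0.
have [C C_gt0 low] := @far_rational R p k n a k0 nE a_lt c0 N0 c0_gt0 gen_far grow g C3
  g_ge0 gN C3_gt0 den_g e ek1.
have hpos B : rational_subspaces R n e B -> 0 < C / height B `^ g e.
  by move=> [_ ratB]; rewrite divr_gt0 // powR_gt0 // (lt_le_trans ltr01) // height_ge1.
have Urat m : rational_subspaces R n e (rowv (map_mx intr (@frame_mx p k n a e m))).
  by apply: rational_rowv => c; apply: (frame_mx_inj k0 nE); rewrite leqW.
have Ainj : forall c : 'rV[R]_p.+1, c *m gen_mx p x = 0 -> c = 0.
  move=> c cA; apply: (far_inj (hpos _ (Urat 0%N)) (low _ (Urat 0%N))).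
  by rewrite cA mem0v.
have dA : \dim A = p.+1 by apply: dim_rowv.
have gd0 : gdim p.+1 e n = 0%N by rewrite /gdim nE subnDl; apply/eqP; rewrite subn_eq0.
split.
  split=> // B rB; rewrite gd0 addn0 (far_capv (hpos B rB) (low B rB)).
  by rewrite dimv0.
rewrite -ge.
have entry i j : `|gen_mx p x i j| <= 2.
  rewrite mxE; case: ifP => [ip|_].
    by have /andP[a0 a2] := gen_entry_le R n0 j ip; rewrite ger0_norm.
  rewrite mxE; case: ifP => _; first by rewrite normr0.
  case: ifP => _; first by rewrite normr1 ler1n.
  by have /andP[l0 l2] := lac_sum_le2 R k a_lt (j - p.+1); rewrite ger0_norm.
pose K : R := n%:R * n%:R * p.+1%:R * 2.
have K0 : 0 < K by rewrite !mulr_gt0 // ltr0n.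
have dimn B : rational_subspaces R n e B -> (p.+1 + \dim B <= n)%N.
  by move=> [-> _]; rewrite nE leq_add2l.
pose ch : R := (n ^ e)%N%:R * (e%:R * (e`!)%N%:R * 2).
have ch0 : 0 < ch by rewrite !mulr_gt0 // ltr0n ?expn_gt0 ?n0 // fact_gt0.
pose cw : R := (n ^ 2)%N%:R * 2 * 4.
have cw0 : 0 < cw by rewrite !mulr_gt0 // ltr0n expn_gt0 n0.
apply: (@mu_exp_eq R n A e (g e) _ (C / K) (fun i =>
  rowv (map_mx intr (@frame_mx p k n a e (i * k)%N)))
   ch cw (fun i => 2 ^+ a (i * k)%N)) => //.
- by rewrite (lt_le_trans ltr01).
- by rewrite divr_gt0.
- move=> B rB; rewrite mulrAC ler_pdivrMr // [leRHS]mulrC.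
  apply: psi_ge_far (low B rB) => //; last exact: dimn.
  by case: rB => ->.
- move=> M; exists (Num.bound M); set i := Num.bound M; set m := (i * k)%N.
  set B := rowv _.
  have dB : \dim B = e by case: (Urat m).
  have am q : (q <= a q)%N.
    by elim: q => [//|q IH]; apply: leq_ltn_trans IH (a_lt q).
  have X1 : 1 <= 2 ^+ a m :> R by rewrite exprn_ege1 // ler1n.
  split=> //.
  + apply: (@le_trans _ _ (2 ^+ i)); first by apply: ltW; apply: upper_nthrootP.
    apply: ler_weXn2l; first by rewrite ler1n.
    by apply: leq_trans (am m); rewrite /m leq_pmulr.
  + exact: Urat.
  + have dB1 : (0 < \dim B <= k)%N by rewrite dB e0.
    have BU : B = rowv (map_mx intr (@frame_mx p k n a (\dim B) m)) by rewrite dB.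
    have /andP[_] := height_frame_mx k0 nE a_lt (Urat m).2 dB1 BU.
    by rewrite dB /ch !mulrA.
  + pose Y := @partial_point R p k n a (m + e.-1).
    have pn : (p < n)%N by rewrite nE addSn ltnS leq_addr.
    have xp : x 0 (Ordinal pn) = 1 by rewrite mxE /= ltnn eqxx.
    have Yp : Y 0 (Ordinal pn) = 1 by rewrite mxE /= ltnn eqxx.
    have x0 : x != 0 by apply/eqP => /rowP/(_ (Ordinal pn)); rewrite xp mxE => /eqP;
      rewrite oner_eq0.
    have Y0 : Y != 0 by apply/eqP => /rowP/(_ (Ordinal pn)); rewrite Yp mxE => /eqP;
      rewrite oner_eq0.
    have YB : Y \in B by apply: partial_point_mem => //; rewrite prednK.
    have xA : x \in A.
      have -> : x = row ord_max (gen_mx p x) by apply/rowP => j; rewrite !mxE ltnn.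
      exact: row_in_rowv.
    have dA0 : (0 < \dim A)%N by rewrite dA.
    have dB0 : (0 < \dim B)%N by rewrite dB.
    have dAB : (\dim A + \dim B <= n)%N by rewrite dA; exact: dimn (Urat m).
    have [_ psi_le] := psi1P dA0 dB0 dAB.
    apply: le_trans (psi_le x Y xA x0 YB Y0) _.
    have Xe0 : 0 < 2 ^+ a (m + e)%N :> R by rewrite exprn_gt0.
    apply: le_trans (@omega_le R n x Y (2 / 2 ^+ a (m + e)%N) _ x0 Y0 _) _.
    * by rewrite divr_ge0 // ltW.
    * move=> j; have -> : x 0 j - Y 0 j = (x - Y) 0 j by rewrite !mxE.
      by have := lac_point_approx R p k a_lt (m + e.-1) j; rewrite -addnS prednK.
    have ex1 : 1 <= enorm x by have := coord_le_enorm x (Ordinal pn); rewrite xp normr1.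
    have ex0 : 0 < enorm x by apply: lt_le_trans ex1.
    have Xlow : (2 ^+ a m) `^ g e <= 2 * 2 ^+ a (m + e)%N :> R.
      rewrite -exprS !pw -powRrM; apply: ler_powR; first by rewrite ler1n.
      apply: (@le_trans _ _ (tau (m + e)%N)); last exact: ltW.
      rewrite tauD (_ : window t m e = g e); last by rewrite -[m]add0n /m (window_per t_per).
      by rewrite ler_wpM2r.
    have Xg0 : 0 < (2 ^+ a m) `^ g e :> R by rewrite powR_gt0 // exprn_gt0.
    rewrite ler_pdivrMr // /cw.
    apply: (@le_trans _ _ ((n ^ 2)%N%:R * 2 * 4 / (2 ^+ a m) `^ g e)); last first.
      by rewrite ler_peMr // divr_ge0 ?mulr_ge0 // ltW.
    rewrite -!mulrA; do 2 (rewrite ler_wpM2l //).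
    rewrite ler_pdivrMr // mulrAC ler_pdivlMr //.
    by move: Xlow; clear; lra.
Qed.

(** * Rational extensions and smooth independence *)

(** Adjoin basis vectors one at a time. *)
Lemma rational_extend (R : realType) (n e e' : nat) (B : {vspace 'rV[R]_n}) :
  (e <= e' <= n)%N -> rational_subspaces R n e B ->
  exists2 B' : {vspace 'rV[R]_n}, (B <= B')%VS & rational_subspaces R n e' B'.
Proof.
move=> /andP[/subnKC <-]; elim: (e' - e)%N => [|r IH] ern rB.
  by exists B; rewrite ?subvv ?addn0.
have [B' BB' [dB' [s sB']]] := IH (leq_trans (leq_add (leqnn e) (leqnSn r)) ern) rB.
have [[i iB']|allB'] := pselect (exists i, delta_mx 0 i \notin B').
  set ei : 'rV[R]_n := delta_mx 0 i in iB' *.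
  exists (<[ei]> + B')%VS; first by rewrite (subv_trans BB') // addvSr.
  have sfree : free (ei :: [seq map_mx (ratr : rat -> R) v | v <- s]).
    by rewrite free_cons (span_basis sB') iB' (basis_free sB').
  have sspan : <<ei :: [seq map_mx (ratr : rat -> R) v | v <- s]>>%VS = (<[ei]> + B')%VS.
    by rewrite span_cons (span_basis sB').
  split; last first.
    exists (delta_mx 0 i :: s); rewrite /= map_delta_mx -/ei /basis_of sspan eqxx.
    exact: sfree.
  have szE : size [seq map_mx (ratr : rat -> R) v | v <- s] = \dim B'.
    by have /eqP <- := basis_free sB'; rewrite (span_basis sB').
  by rewrite -sspan (eqP sfree) /= szE dB' addnS.
have B'T : B' = fullv.
  apply/eqP; rewrite eqEsubv subvf /=; apply/subvP => v _.
  rewrite (row_sum_delta v); apply: rpred_sum => i _; apply: rpredZ.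
  by apply: contraT => iB'; case: allB'; exists i.
move: dB'; rewrite B'T dimvf dim_matrix [LHS]mul1r => nE.
by move: ern; rewrite {1}nE addnS ltnn.
Qed.

Lemma submersion_not_locally_zero (R : realType) (k : nat) (h : 'rV[R]_k -> R^o) (a : 'rV[R]_k) :
  is_submersion h -> ~ \forall b \near a, h b = 0.
Proof.
move=> [h_smooth h_surj] h0.
have [dh _] := h_smooth 1%N.
have [v v1] := h_surj a 1.
have := v1; rewrite -deriveE // (@near_eq_derive _ _ _ h (cst 0)) //.
by rewrite derive_cst => /eqP; rewrite eq_sym oner_eq0.
Qed.

Section Ratios.
Variables (R : realType) (k : nat) (S : R).
Hypothesis S0 : 0 < S.

(** Any strictly decreasing values above [S] would do; steps of length 1 leave
    room for perturbations by 1/2. *)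
Definition slope (i : nat) : R := S + (k - i)%N%:R.

Definition base : 'rV[R]_k := \row_(i < k) \prod_(l < i.+1) slope l.

Definition coord_or0 (b : 'rV[R]_k) (i : nat) : R :=
  if insub i is Some r then b 0 r else 0.

(** Recovers the factors t_i from the products t_0 ... t_i. *)
Definition ratio (b : 'rV[R]_k) (i : nat) : R :=
  coord_or0 b i / (if i is i'.+1 then coord_or0 b i' else 1).

Lemma coord_or0E b (i : 'I_k) : coord_or0 b i = b 0 i.
Proof. by rewrite /coord_or0 valK. Qed.

Lemma slope_gt0 i : 0 < slope i. Proof. by rewrite ltr_pwDl. Qed.

Lemma ratio_near : \forall b \near base, forall i : 'I_k, `|ratio b i - slope i| < 2^-1.
Proof.
suff H (i : 'I_k) : \forall b \near base, `|ratio b i - slope i| < 2^-1.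
  exact: (@filter_forall _ _ _ _ (nbhs_filter base) H).
case: i => i ik.
have base_ne0 (r : 'I_k) : base 0 r != 0.
  by rewrite mxE gt_eqF //; apply: prodr_gt0 => l _; exact: slope_gt0.
have [f [fE cont val_base]] : exists f : 'rV[R]_k -> R,
    [/\ forall b, ratio b i = f b, {for base, continuous f} & f base = slope i].
  case: i ik => [|i] ik.
    exists (fun b => b 0 (Ordinal ik)); split=> [b||].
    - by rewrite /ratio (coord_or0E _ (Ordinal ik)) divr1.
    - exact: coord_continuous.
    - by rewrite mxE big_ord_recl big_ord0 mulr1.
  have ik' := ltnW ik.
  exists (fun b => b 0 (Ordinal ik) * (b 0 (Ordinal ik'))^-1); split=> [b||].
  - by rewrite /ratio (coord_or0E _ (Ordinal ik)) (coord_or0E _ (Ordinal ik')).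
  - apply: continuousM; first exact: coord_continuous.
    by apply: continuousV; [exact: base_ne0|exact: coord_continuous].
  - have := base_ne0 (Ordinal ik'); rewrite !mxE /= => nz.
    by rewrite big_ord_recr /= mulrAC divff ?mul1r.
have h2 : (0 : R) < 2^-1 by rewrite invr_gt0.
move/cvgrPdist_lt : cont => /(_ _ h2); rewrite val_base.
by apply: filterS => b; rewrite fE distrC.
Qed.

Lemma ratio_prod b : (forall i : 'I_k, ratio b i != 0) ->
  forall i : 'I_k, \prod_(l < i.+1) ratio b l = b 0 i.
Proof.
move=> nz; suff H i : (i < k)%N -> \prod_(l < i.+1) ratio b l = coord_or0 b i.
  by move=> i; rewrite H // coord_or0E.
elim: i => [|i IH] ik; rewrite big_ord_recr /=.
  by rewrite big_ord0 mul1r /ratio divr1.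
rewrite IH ?(ltnW ik) // /ratio mulrC divfK //.
apply: contraNneq (nz (Ordinal ik)) => c0.
by rewrite /ratio /= c0 invr0 mulr0.
Qed.

End Ratios.

(** Close to [base], the consecutive ratios still decrease and stay above [S], so
    every point close to [base] is a tuple of exponents, where h vanishes. *)
Lemma exponents_independent (R : realType) (p k n : nat) : (0 < k)%N -> n = (p.+1 + k)%N ->
  smoothly_independent
    (\bigcap_(e in [set e : nat | (1 <= e <= k)%N]) irrational_subspaces R n p.+1 e 1)
    (fun (i : 'I_k) (A : {vspace 'rV[R]_n}) => mu_exp i.+1 1 A).
Proof.
move=> k0 nE [h [hsub hvanish]].
have [S S0 AS] := exists_subspace R k0 nE.
apply: (submersion_not_locally_zero (a := base k S) hsub).
apply: filterS (ratio_near k S0) => b bnear.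
pose t i := ratio b (i %% k)%N.
have tP i : (S + (k - i %% k)%N%:R) - 2^-1 < t i < (S + (k - i %% k)%N%:R) + 2^-1.
  have := bnear (Ordinal (ltn_pmod i k0)).
  by rewrite /= ltr_distl /slope.
have tS i : S <= t i.
  have /andP[+ _] := tP i; have : 1 <= (k - i %% k)%N%:R :> R by rewrite ler1n subn_gt0 ltn_pmod.
  by move=> *; lra.
have t_per i : t (i + k)%N = t i by rewrite /t modnDr.
have t_anti i j : (i <= j < k)%N -> t j <= t i.
  move=> /andP[]; rewrite leq_eqVlt => /orP[/eqP -> //|ij jk].
  have /andP[ti _] := tP i; have /andP[_ tj] := tP j.
  rewrite !modn_small // ?(ltn_trans ij) // in ti tj.
  have : (k - j)%N%:R + 1 <= (k - i)%N%:R :> R by rewrite natr1 ler_nat ltn_sub2l // (ltn_trans ij).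
  by move=> *; lra.
have [A AP] := AS t tS t_per t_anti.
have tprod (i : 'I_k) : \prod_(l < i.+1) t l = b 0 i.
  rewrite -(ratio_prod (b := b)); last first.
    move=> l; have := tS l; rewrite /t modn_small // => H.
    by rewrite gt_eqF // (lt_le_trans S0).
  apply: eq_bigr => l _; rewrite /t modn_small //.
  by apply: leq_trans (ltn_ord l) _.
have muE (i : 'I_k) : mu_exp i.+1 1 A = (b 0 i)%:E.
  by have [_ ->] := AP i.+1 (ltn_ord i); rewrite tprod.
have := hvanish A; rewrite (_ : \row_i fine (mu_exp i.+1 1 A) = b); last first.
  by apply/rowP => i; rewrite mxE muE.
by apply => [e ek|i]; [have [] := AP e ek|rewrite muE].
Qed.

Lemma bigcap_irrational (R : realType) (n d : nat) : (0 < d < n)%N ->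
  \bigcap_(e in [set e : nat | (1 <= e <= n - d)%N]) irrational_subspaces R n d e 1
    = irrational_subspaces R n d (n - d) 1.
Proof.
move=> /andP[d0 dn]; apply/seteqP; split => A /=.
  by apply; rewrite /= leqnn subn_gt0 dn.
move=> [dA AI] e /= /andP[e0 ed]; split=> // B rB.
have end_ : (e <= n - d <= n)%N by rewrite ed leq_subr.
have [B' BB' rB'] := rational_extend end_ rB.
apply: leq_ltn_trans (dimvS (capvS (subvv A) BB')) _.
apply: leq_trans (AI B' rB') _; rewrite leq_add2l /gdim subnKC ?subnn //.
exact: ltnW.
Qed.

Theorem theorem1p4 (R : realType) (n d : nat) (hn : (2 <= n)%N)
    (hd : (1 <= d <= n - 1)%N) :
  \bigcap_(e in [set e : nat | (1 <= e <= n - d)%N])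
      irrational_subspaces R n d e 1
    = irrational_subspaces R n d (n - d) 1 /\
  smoothly_independent
    (\bigcap_(e in [set e : nat | (1 <= e <= n - d)%N])
       irrational_subspaces R n d e 1)
    (fun (i : 'I_(n - d)) (A : {vspace 'rV[R]_n}) => mu_exp i.+1 1 A).
Proof.
have dn : (0 < d < n)%N by lia.
split; first exact: bigcap_irrational.
case: d hd dn => // p _ /andP[_ pn].
by apply: exponents_independent; rewrite ?subn_gt0 // subnKC // ltnW.
Qed.
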